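(* Let $\alpha>1$, and let $\nu$ be a finite positive Borel measure on $(1/2,\infty)$. Define $$\varrho(n)=d_\alpha(n)\int_{1/2}^\infty n^{-s}\,d\nu(s),\qquad n\ge1,$$ and let $\mathcal H_{\varrho,d_\alpha}$ be the weighted multiplicative Hankel form induced by $\varrho$ (see context). Then the following conditions are equivalent. (1) The form $\mathcal H_{\varrho,d_\alpha}$ is a bounded bilinear form on $\ell^2_{d_\alpha}(\mathbb N)$. (2) There is a constant $C>0$ such that $\nu\bigl((1/2,1/2+\varepsilon]\bigr)\le C\varepsilon^\alpha$ as $\varepsilon\to0^+$ (i.e. for all sufficiently small $\varepsilon>0$). (3) There is a constant $C>0$ such that $$\varrho(n)\le C\frac{d_\alpha(n)}{\sqrt n\,(\log n)^\alpha},\qquad n\ge2.$$ (4) The operator $$(\mathcal K_{\alpha,\nu}f)(t)=\int_{1/2}^\infty\zeta(s+t)^\alpha f(s)\,d\nu(s),\qquad t>\tfrac12,$$ is bounded on $L^2(\nu)$.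
   Context: For $\alpha>1$ the coefficients $d_\alpha(n)>0$ are defined by $\zeta(s)^\alpha=\sum_{n\ge1}d_\alpha(n)n^{-s}$, $\operatorname{Re}s>1$. The space $\ell^2_{d_\alpha}(\mathbb N)$ consists of complex sequences $a=(a_n)_{n\ge1}$ with $\|a\|_{\ell^2_{d_\alpha}}^2:=\sum_{n\ge1}|a_n|^2/d_\alpha(n)<\infty$. For a complex sequence $\varrho=(\varrho(n))_{n\ge1}$, the weighted multiplicative Hankel form is defined on finitely supported sequences by $$\mathcal H_{\varrho,d_\alpha}(a,b)=\sum_{m,n\ge1}a_mb_n\frac{\varrho(mn)}{d_\alpha(mn)},$$ and it is called bounded if there is $C$ with $|\mathcal H_{\varrho,d_\alpha}(a,b)|\le C\|a\|_{\ell^2_{d_\alpha}}\|b\|_{\ell^2_{d_\alpha}}$ for all finitely supported $a,b$. *)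

(* Defs.v *)
From HB Require Import structures.
From mathcomp Require Export all_boot all_order all_algebra.
From mathcomp Require Export all_classical all_reals all_analysis.
From mathcomp Require Export complex.

Set Implicit Arguments.
Unset Strict Implicit.
Unset Printing Implicit Defensive.

Import Order.TTheory GRing.Theory Num.Theory.
Import numFieldNormedType.Exports.

Local Open Scope classical_set_scope.
Local Open Scope ring_scope.
Local Open Scope complex_scope.

Notation cabs := ComplexField.Normc.normc.

(** Sequences indexed by n >= 1 are functions on nat whose value at 0 is never
    used. *)

Section ZetaPowers.
Context {R : realType}.

Definition cexp (z : R[i]) : R[i] :=
  (expR (complex.Re z))%:C * (cos (complex.Im z) +i* sin (complex.Im z)).

(* n ^ s for n >= 1 *)
Definition cnatpow (n : nat) (s : R[i]) : R[i] := cexp (s * (ln n%:R)%:C).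

(* Partial sums a_1 1^{-s} + ... + a_N N^{-s}; R[i]^o is R[i] with its norm
   topology. *)
Definition dirichlet_series (a : nat -> R[i]) (s : R[i]) : nat -> R[i]^o :=
  series (fun n => a n.+1 * cnatpow n.+1 (- s) : R[i]^o).

(* Meaningful for Re s > 1 only. *)
Definition zeta (s : R[i]) : R[i] := limn (dirichlet_series (fun=> 1) s).

(* The branch of log zeta on Re s > 1 that is real on the real half-line. The
   principal logarithm would not do: arg zeta is unbounded on Re s > 1. *)
Definition is_log_zeta (L : R[i] -> R[i]) : Prop :=
  [/\ forall s : R[i]^o, 1 < complex.Re s ->
        {for s, continuous (L : R[i]^o -> R[i]^o)},
      forall s : R[i], 1 < complex.Re s -> cexp (L s) = zeta s
    & forall x : R, 1 < x -> complex.Im (L x%:C) = 0].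

(* d = d_alpha, the (positive) Dirichlet coefficients of
   zeta^alpha = exp (alpha log zeta); uniqueness of Dirichlet coefficients
   makes d n unique for n >= 1. *)
Definition zeta_power_coeffs (alpha : R) (d : nat -> R) : Prop :=
  (forall n, (1 <= n)%N -> 0 < d n) /\
  exists2 L, is_log_zeta L &
    forall s : R[i], 1 < complex.Re s ->
      dirichlet_series (fun n => (d n)%:C) s @ \oo
        --> (cexp (alpha%:C * L s) : R[i]^o).

(* zeta(x)^alpha for real x > 1, where zeta(x) is real and positive. *)
Definition zeta_powR (alpha x : R) : R := (complex.Re (zeta x%:C)) `^ alpha.

End ZetaPowers.

Section HankelForm.
Context {R : realType}.

Definition finitely_supported (a : nat -> R[i]) : Prop :=
  finite_set [set n | a n != 0].

(* The norm of l^2_d for sequences belonging to that space. *)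
Definition l2norm (d : nat -> R) (a : nat -> R[i]) : R :=
  Num.sqrt (fine (\sum_(1 <= n <oo) (cabs (a n) ^+ 2 / d n)%:E)%E).

(* Sums over an infinite set, meant for finitely supported a and b only. *)
Definition hankel_form (rho : nat -> R[i]) (d : nat -> R)
    (a b : nat -> R[i]) : R[i] :=
  \sum_(m \in [set m | (1 <= m)%N]) \sum_(n \in [set n | (1 <= n)%N])
    a m * b n * (rho (m * n)%N / (d (m * n)%N)%:C).

Definition hankel_bounded (rho : nat -> R[i]) (d : nat -> R) : Prop :=
  exists C : R, forall a b : nat -> R[i],
    finitely_supported a -> finitely_supported b ->
    cabs (hankel_form rho d a b) <= C * l2norm d a * l2norm d b.

End HankelForm.

Section MeasureSide.
Context {R : realType}.

Definition half_line : set R := `]2^-1, +oo[.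

(* Finite Borel measures on (1/2, oo) are identified with the finite Borel
   measures on R that vanish off (1/2, oo). *)
Definition measure_on_half_line (nu : {finite_measure set R -> \bar R}) : Prop :=
  nu (~` half_line) = 0%E.

Definition varrho (d : nat -> R) (nu : {finite_measure set R -> \bar R})
    (n : nat) : R :=
  d n * \int[nu]_(s in half_line) (n%:R `^ (- s)).

Definition cintegral (nu : {finite_measure set R -> \bar R}) (f : R -> R[i])
    : R[i] :=
  (\int[nu]_(s in half_line) complex.Re (f s)) +i*
  (\int[nu]_(s in half_line) complex.Im (f s)).

(* Complex L^2(nu), at the level of representatives. *)
Definition L2sqnorm (nu : {finite_measure set R -> \bar R}) (f : R -> R[i])
    : \bar R :=
  (\int[nu]_(s in half_line) (cabs (f s) ^+ 2)%:E)%E.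

Definition inL2 (nu : {finite_measure set R -> \bar R}) (f : R -> R[i])
    : Prop :=
  [/\ measurable_fun half_line (fun s => complex.Re (f s)),
      measurable_fun half_line (fun s => complex.Im (f s))
    & (L2sqnorm nu f < +oo)%E].

Definition L2norm (nu : {finite_measure set R -> \bar R}) (f : R -> R[i]) : R :=
  Num.sqrt (fine (L2sqnorm nu f)).

(* For f in L^2(nu) and t > 1/2 the integrand is nu-integrable, since
   s |-> zeta(s+t)^alpha is bounded on (1/2, oo) and nu is finite. *)
Definition Kop (alpha : R) (nu : {finite_measure set R -> \bar R})
    (f : R -> R[i]) (t : R) : R[i] :=
  cintegral nu (fun s => (zeta_powR alpha (s + t))%:C * f s).

Definition L2_bounded (nu : {finite_measure set R -> \bar R})
    (T : (R -> R[i]) -> (R -> R[i])) : Prop :=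
  exists C : R, forall f : R -> R[i],
    inL2 nu f -> inL2 nu (T f) /\ L2norm nu (T f) <= C * L2norm nu f.

End MeasureSide.

(* Main.v *)
Require Import Defs.
From mathcomp Require Import measurable_realfun ring lra zify.
Import Order.TTheory GRing.Theory Num.Theory.
Import numFieldNormedType.Exports.
Local Open Scope classical_set_scope.
Local Open Scope ring_scope.
Local Open Scope complex_scope.

(** Everything is compared with the growth condition (2). With
    M_k = \int k^(-s) dnu(s), the Hankel matrix is (M_(mn)), and
    zeta(s+t)^alpha = sum_n d_n n^(-s) n^(-t) is comparable to
    1 + (s+t-1)^(-alpha).

    (2) => (1): put y = s - 1/2 and h(s) = 1 + y^(-alpha/2). Decomposing
    dyadically, (2) gives \int zeta(s+t)^alpha h(t) dnu(t) <= K h(s). Hence the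
    vector p_n = \int n^(-t) h(t) dnu(t) + n^(-2) satisfies
    sum_(n <= N) d_n p_n M_(mn) <= K p_m, and the Schur test bounds the form.
    The summand n^(-2) only serves to keep p_n positive when nu = 0.

    (2) => (4): with u_n = \int n^(-s) f dnu, the truncations
    K_N f (t) = sum_(n <= N) d_n u_n n^(-t) satisfy
    ||K_N f||^2 <= K sum_(n <= N) d_n u_n^2 by the bound on the Hankel form, and
    sum_(n <= N) d_n u_n^2 = <f, K_N f>; so ||K_N f|| <= K ||f||, and Fatou's
    lemma concludes. Real and imaginary parts are treated separately.

    (2) => (3): slice (1/2, oo) into intervals of length 1/log n.

    Conversely, (2) is recovered by testing (1) on a_n = d_n n^(-1/2-e), n <= N,
    testing (4) on the indicator of (1/2, 1/2+e], and taking n close to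
    exp(1/e) in (3). *)

(** * Zeta and its powers on the real axis, through partial sums of Dirichlet series *)

Section Zeta.
Context {R : realType}.
Implicit Types (x y : R) (a d : nat -> R).

Lemma cvg_complex_Re (u : nat -> R[i]^o) (l : R[i]^o) :
  u @ \oo --> l -> (fun n => complex.Re (u n)) @ \oo --> complex.Re l.
Proof.
move=> /cvgrPdist_lt ul; apply/cvgrPdist_lt => e e0.
have e0' : 0 < (e%:C : R[i]) by rewrite ltcR.
near=> n.
have : `|l - u n| < e%:C by near: n; exact: ul.
move=> H; rewrite -ltcR; apply: le_lt_trans H.
have := normc_ge_Re (l - u n); congr (`|_|%:C <= _).
by case: (l) (u n) => [? ?] [].
Unshelve. all: by end_near. Qed.

Lemma cvg_real_complex (u : nat -> R) (l : R) :
  u @ \oo --> l -> (fun n => (u n)%:C : R[i]^o) @ \oo --> (l%:C : R[i]^o).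
Proof.
move=> /cvgrPdist_lt ul; apply/cvgrPdist_lt => e e0.
have [er ee] : exists er, e = er%:C.
  by apply/complex_realP; exact: gtr0_real.
have er0 : 0 < er by rewrite -ltcR -ee.
near=> n.
have : `|l - u n| < er by near: n; exact: ul.
rewrite -ltcR -ee; congr (_ < _).
by rewrite -rmorphB /= normc_def /= expr0n addr0 sqrtr_sqr.
Unshelve. all: by end_near. Qed.

Lemma cexp_real x : cexp x%:C = (expR x)%:C :> R[i].
Proof. by rewrite /cexp /= cos0 sin0 mulr1. Qed.

Lemma cnatpow_real n x :
  cnatpow n.+1 (- x%:C) = (n.+1%:R `^ (- x))%:C :> R[i].
Proof.
rewrite /cnatpow -rmorphN -rmorphM cexp_real /powR.
by rewrite (negbTE (lt0r_neq0 _)).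
Qed.

Definition dpsum a x N : R :=
  \sum_(0 <= n < N) a n.+1 * n.+1%:R `^ (- x).

Lemma dpsumS a x N :
  dpsum a x N.+1 = dpsum a x N + a N.+1 * N.+1%:R `^ (- x).
Proof. by rewrite /dpsum big_nat_recr. Qed.

Lemma dirichlet_series_real a x :
  dirichlet_series (fun n => (a n)%:C) x%:C = fun N => (dpsum a x N)%:C.
Proof.
apply/funext => N; rewrite /dirichlet_series /series /dpsum /= rmorph_sum /=.
by apply: eq_bigr => n _; rewrite cnatpow_real rmorphM.
Qed.

Lemma dpsum_nondecreasing a x : (forall n, (1 <= n)%N -> 0 <= a n) ->
  nondecreasing_seq (dpsum a x).
Proof.
move=> a0; apply/nondecreasing_seqP => N; rewrite dpsumS.
by rewrite lerDl mulr_ge0 ?a0 // powR_ge0.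
Qed.

(** A discrete replacement for comparing the sum of n^(-1-e) with an integral: consecutive
    differences of n^(-e) telescope. Both halves come from 1 + x <= exp x and ln(1 + x) <= x,
    applied to the ratio of neighbouring integers. *)
Lemma powRN_step n (e : R) : 0 < e ->
  e * n.+2%:R `^ (- (1 + e)) <= n.+1%:R `^ (- e) - n.+2%:R `^ (- e)
    <= e * n.+1%:R `^ (- (1 + e)).
Proof.
move=> e0.
have n1 : 0 < n.+1%:R :> R by [].
have n2 : 0 < n.+2%:R :> R by [].
have E (m : nat) (z : R) : m.+1%:R `^ (- (1 + z)) =
  m.+1%:R `^ (- z) / m.+1%:R :> R.
  by rewrite opprD addrC powRD ?pnatr_eq0 ?implybT // powR_inv1.
have nn : n.+2%:R = n.+1%:R + 1 :> R by rewrite -natr1.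
rewrite !E; apply/andP; split.
- have -> : n.+1%:R `^ (- e) =
      n.+2%:R `^ (- e) * (n.+1%:R / n.+2%:R) `^ (- e) :> R.
    rewrite -powRM ?divr_ge0 //; congr (_ `^ _).
    by rewrite mulrCA divff ?mulr1 // pnatr_eq0.
  have : 1 + e / n.+2%:R <= (n.+1%:R / n.+2%:R : R) `^ (- e).
    rewrite /powR (negbTE (lt0r_neq0 _)) ?divr_gt0 //.
    apply: le_trans (expR_ge1Dx _); rewrite lerD2l mulNr -mulrN.
    apply: ler_wpM2l; first exact: ltW.
    rewrite lerNr; have -> : n.+1%:R / n.+2%:R = 1 + - n.+2%:R^-1 :> R.
      apply: (mulIf (lt0r_neq0 n2)); rewrite divfK ?lt0r_neq0 // mulrDl mulNr.
      by rewrite mulVf ?lt0r_neq0 // mul1r nn addrK.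
    apply: le_ln1Dx; rewrite ltrN2 invf_lt1 // ltr1n //.
  move=> H; have := ler_wpM2l (powR_ge0 n.+2%:R (- e)) H.
  by rewrite lerBrDl mulrDr mulr1 mulrCA.
- have -> : n.+2%:R `^ (- e) =
      n.+1%:R `^ (- e) * (n.+2%:R / n.+1%:R) `^ (- e) :> R.
    rewrite -powRM ?divr_ge0 //; congr (_ `^ _).
    by rewrite mulrCA divff ?mulr1 // pnatr_eq0.
  have : 1 - e / n.+1%:R <= (n.+2%:R / n.+1%:R : R) `^ (- e).
    rewrite /powR (negbTE (lt0r_neq0 _)) ?divr_gt0 //.
    apply: le_trans (expR_ge1Dx _); rewrite lerD2l mulNr lerN2.
    apply: ler_wpM2l; first exact: ltW.
    have -> : n.+2%:R / n.+1%:R = 1 + n.+1%:R^-1 :> R.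
      by rewrite nn mulrDl mul1r divff // lt0r_neq0.
    by apply: le_ln1Dx; apply: (@lt_trans _ _ 0); rewrite ?invr_gt0 ?ltrN10.
  move=> H; have := ler_wpM2l (powR_ge0 n.+1%:R (- e)) H.
  by rewrite lerBlDr -lerBlDl mulrBr mulr1 mulrCA.
Qed.

Lemma dpsum1_ub (e : R) N : 0 < e -> dpsum (fun=> 1) (1 + e) N <= 1 + e^-1.
Proof.
move=> e0.
(* Telescoping the lower half of [powRN_step]; the summand e on the right pays for the first term of
   the series, which that lemma does not reach. *)
have H : e * dpsum (fun=> 1) (1 + e) N.+1 <= e + 1 - N.+1%:R `^ (- e).
  elim: N => [|N IH].
    by rewrite /dpsum big_nat1 powR1; lra.
  rewrite dpsumS mulrDr mul1r.
  have /andP[+ _] := @powRN_step N e e0; move: IH.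
  move: (dpsum _ _ _) (N.+1%:R `^ _) (N.+2%:R `^ (- (1 + e))) (N.+2%:R `^ _).
  by move=> *; lra.
apply: (@le_trans _ _ (dpsum (fun=> 1) (1 + e) N.+1)).
  exact: (dpsum_nondecreasing (fun=> 1)).
rewrite -(ler_pM2l e0) mulrDr mulfV ?lt0r_neq0 // mulr1.
by have := powR_ge0 N.+1%:R (- e); lra.
Qed.

Lemma dpsum1_lb (e : R) N : 0 < e ->
  1 - N.+1%:R `^ (- e) <= e * dpsum (fun=> 1) (1 + e) N.
Proof.
move=> e0; elim: N => [|N IH].
  by rewrite /dpsum big_geq // mulr0 powR1 subrr.
rewrite dpsumS mulrDr mul1r.
have /andP[_] := @powRN_step N e e0; move: IH.
move: (dpsum _ _ _) (N.+1%:R `^ (- e)) (N.+2%:R `^ _) (N.+1%:R `^ _).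
by move=> *; lra.
Qed.

Lemma zeta_real (x : R) : 1 < x ->
  zeta x%:C = (limn (dpsum (fun=> 1) x))%:C
  /\ dpsum (fun=> 1) x @ \oo --> limn (dpsum (fun=> 1) x).
Proof.
move=> x1.
have c : dpsum (fun=> 1) x @ \oo --> limn (dpsum (fun=> 1) x).
  apply: nondecreasing_is_cvgn; first exact: dpsum_nondecreasing.
  exists (1 + (x - 1)^-1) => _ [N _ <-].
  have -> : x = 1 + (x - 1) by lra.
  have -> : 1 + (x - 1) - 1 = x - 1 by lra.
  by apply: dpsum1_ub; lra.
split=> //; rewrite /zeta.
have := dirichlet_series_real (fun=> 1) x => ->.
exact: (cvg_lim (@norm_hausdorff _ _) (cvg_real_complex _ _ c)).
Qed.

Lemma zeta_bounds (e : R) : 0 < e ->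
  (2 * e)^-1 <= complex.Re (zeta (1 + e)%:C) <= 1 + e^-1.
Proof.
move=> e0; have [|-> c] := @zeta_real (1 + e); first lra.
rewrite /=; have nd := dpsum_nondecreasing _ (1 + e) (fun (n : nat) _ => ler01).
apply/andP; split; last first.
  apply: limr_le; first by apply/cvg_ex; eexists; exact: c.
  by apply: nearW => N; exact: dpsum1_ub.
(* With this [N], N + 1 > 2^(1/e), so (N + 1)^(-e) <= 1/2 and [dpsum1_lb] gives at least 1/2 for e
   times the partial sum. *)
pose N := (Num.truncn ((2 : R) `^ e^-1)).
apply: (@le_trans _ _ (dpsum (fun=> 1) (1 + e) N)); last first.
  by apply: nondecreasing_cvgn_le => //; apply/cvg_ex; eexists; exact: c.
rewrite -(ler_pM2l e0); apply: le_trans (@dpsum1_lb e N e0).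
have -> : e * (2 * e)^-1 = 2^-1 by field; rewrite lt0r_neq0.
have : N.+1%:R `^ (- e) <= (2:R)^-1.
  rewrite powRN lef_pV2 ?posrE ?powR_gt0 //.
  have {1}-> : (2:R) = (2 `^ e^-1) `^ e.
    by rewrite -powRrM mulVf ?lt0r_neq0 // powRr1.
  apply: ge0_ler_powR; rewrite ?nnegrE ?powR_ge0 //; first exact: ltW.
  by apply: ltW; apply: truncnS_gt.
lra.
Qed.

(** The chosen branch L of log zeta is real at real x, so exp(alpha L(x)) is the ordinary real power
    of zeta(x) = exp(L(x)). From here on complex arguments of zeta no longer matter. *)
Lemma zeta_powR_cvg alpha d : zeta_power_coeffs alpha d -> forall x, 1 < x ->
  dpsum d x @ \oo --> zeta_powR alpha x.
Proof.
move=> [_ [L [_ Lz Lr] Ld]] x x1.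
have := Ld x%:C x1; rewrite dirichlet_series_real => /cvg_complex_Re.
have zL : zeta x%:C = cexp (L x%:C) by rewrite Lz.
have [l ll] : exists l, L x%:C = l%:C.
  by case: (L x%:C) (Lr x x1) => l i /= ->; exists l.
rewrite /zeta_powR zL ll -rmorphM !cexp_real /=.
rewrite [in X in _ -> X]/powR (negbTE (lt0r_neq0 (expR_gt0 _))) expRK.
exact.
Qed.

End Zeta.

(** * Integrals against a measure satisfying the growth condition *)

Section Growth.
Context {R : realType}.
Variables (nu : {finite_measure set R -> \bar R}) (alpha C0 : R).
Hypothesis alpha_gt0 : 0 < alpha.
Hypothesis C0_ge0 : 0 <= C0.
Hypothesis nu_growth : forall r : R, 0 < r ->
  (nu (`]2^-1, 2^-1 + r]%classic)%R <= (C0 * r `^ alpha)%:E)%E.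

Local Notation D := (@half_line R).

Lemma measurable_half_line : measurable (@half_line R).
Proof. exact: measurable_itv. Qed.
Let mD := measurable_half_line.

Lemma half_lineE (s : R) : half_line s = (2^-1 < s) :> Prop.
Proof. by rewrite /half_line /= in_itv /= andbT. Qed.

(** The function g is dominated by the sum over k of c_k times the indicator of (1/2, 1/2 + r_k]. By
    the growth condition the k-th term integrates to at most C0 c_k r_k^alpha <= C0 A q^k, and the
    geometric series is summed. The near, far and exponential estimates below are instances. *)
Lemma layered_integral_le (g : R -> R) (c r : nat -> R) (A q : R) :
  measurable_fun D g -> (forall s, D s -> 0 <= g s) ->
  (forall k, 0 <= c k) -> (forall k, 0 < r k) -> 0 <= q -> q < 1 ->
  (forall k, c k * r k `^ alpha <= A * q ^+ k) ->
  (forall s, D s -> g s = 0 \/ exists2 k, s <= 2^-1 + r k & g s <= c k) ->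
  (\int[nu]_(s in D) (g s)%:E <= (C0 * A / (1 - q))%:E)%E.
Proof.
move=> mg g0 c0 r0 q0 q1 cr gk.
pose J k : set R := `]2^-1, 2^-1 + r k]%classic.
have mJ k : measurable (J k) by exact: measurable_itv.
pose G k (s : R) := (c k * \1_(J k) s)%:E.
have G0 k s : (0 <= G k s)%E by rewrite lee_fin mulr_ge0.
have mG k : measurable_fun D (G k).
  apply/measurable_EFinP; apply: measurable_funM; [exact: measurable_cst|].
  exact: measurable_indic.
have A0 : 0 <= A.
  by have := cr 0%N; rewrite expr0 mulr1; apply: le_trans;
    rewrite mulr_ge0 ?powR_ge0.
apply: (@le_trans _ _ (\int[nu]_(s in D) (\sum_(k <oo) G k s))%E).
  apply: ge0_le_integral => //.
  - exact/measurable_EFinP.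
  - by apply: ge0_emeasurable_sum => // k s Ds _; exact: G0.
  - move=> s Ds; have [->|[k sk gc]] := gk s Ds; first by apply: nneseries_ge0.
    apply: (@le_trans _ _ (\sum_(0 <= i < k.+1) G i s)%E); last first.
      by apply: nneseries_lim_ge => *; exact: G0.
    rewrite big_nat_recr //= -[leLHS]add0e; apply: leeD; first exact: sume_ge0.
    rewrite lee_fin indicE mem_set ?mulr1 //.
    by rewrite /J /= in_itv /= sk andbT -half_lineE.
rewrite integral_nneseries //.
apply: (@le_trans _ _ (\sum_(k <oo) (C0 * A * q ^+ k)%:E)%E).
  apply: lee_nneseries => [k _ _|k _]; first by apply: integral_ge0.
  under eq_integral do rewrite /G EFinM.
  rewrite ge0_integralZl_EFin //; last exact/measurable_EFinP/measurable_indic.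
  rewrite integral_indic // (_ : J k `&` D = J k); last first.
    apply/setIidPl => s; rewrite /J /= in_itv /= => /andP[h _].
    by rewrite half_lineE.
  apply: le_trans (lee_wpmul2l _ (nu_growth _ (r0 k))) _;
    first by rewrite lee_fin.
  rewrite -EFinM lee_fin mulrCA -mulrA; exact: ler_wpM2l.
apply: lime_le; first by apply: is_cvg_nneseries => k _ _;
  rewrite lee_fin !mulr_ge0 ?exprn_ge0.
apply: nearW => N; rewrite sumEFin lee_fin.
have := geometric_seriesE (C0 * A) (negbT (lt_eqF q1)).
move=> /(congr1 (fun f => f N)) /=.
rewrite /series /= => ->.
rewrite ler_pM2r ?invr_gt0 ?subr_gt0 // ler_piMr ?mulr_ge0 //.
by rewrite gerBl exprn_ge0.
Qed.


Lemma dyadic_up (x y : R) : 0 < x -> x < y ->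
  exists k : nat, x * 2 ^+ k < y <= x * 2 ^+ k.+1.
Proof.
move=> x0 xy.
have ex : exists k, y <= x * 2 ^+ k.+1.
  exists (Num.truncn (y / x)).
  rewrite mulrC -ler_pdivrMr //; apply: (le_trans (ltW (truncnS_gt _))).
  rewrite -natrX ler_nat; exact/ltnW/ltn_expl.
case: (ex_minnP ex) => k yk kmin; exists k; rewrite yk andbT.
case: k yk kmin => [_ _|k _ kmin]; first by rewrite expr0 mulr1.
by rewrite ltNge; apply/negP => /kmin; rewrite ltnn.
Qed.

Lemma dyadic_down (x y : R) : 0 < y -> y <= x ->
  exists k : nat, x / 2 ^+ k.+1 < y <= x / 2 ^+ k.
Proof.
move=> y0 yx; have x0 : 0 < x by exact: lt_le_trans yx.
have P (n : nat) : 0 < (2 ^+ n : R) by exact: exprn_gt0.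
have ex : exists k, x / 2 ^+ k.+1 < y.
  exists (Num.truncn (x / y)).
  rewrite ltr_pdivrMr // mulrC -ltr_pdivrMr //.
  apply: (lt_trans (truncnS_gt _)).
  by rewrite -natrX ltr_nat ltn_expl.
case: (ex_minnP ex) => k yk kmin; exists k; rewrite yk /=.
case: k yk kmin => [_ _|k _ kmin]; first by rewrite expr0 divr1.
by rewrite leNgt; apply/negP => /kmin; rewrite ltnn.
Qed.

Lemma powR_inv_le (b x y : R) : 0 <= b -> 0 < x -> x <= y -> y `^ (- b) <=
  x `^ (- b).
Proof.
move=> b0 x0 xy; have y0 := lt_le_trans x0 xy.
rewrite !powRN lef_pV2 ?posrE ?powR_gt0 //.
by apply: ge0_ler_powR => //; rewrite nnegrE ltW.
Qed.

Lemma measurable_powR_shift (A : set R) (x b : R) :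
  measurable_fun A (fun s : R => (s + x) `^ b).
Proof.
apply: (@measurableT_comp _ _ _ _ _ _ (fun z : R => z `^ b));
  first exact: measurable_powR.
by apply: measurable_funD; [exact: measurable_id|exact: measurable_cst].
Qed.

Lemma powRDpos (x a b : R) : 0 < x -> x `^ (a + b) = x `^ a * x `^ b.
Proof. by move=> x0; rewrite powRD // lt0r_neq0 ?implybT. Qed.

Lemma powR1r (b : R) : 1 `^ b = 1 :> R.
Proof. by rewrite powR1. Qed.

Lemma powR2X (b : R) k : (2 ^+ k : R) `^ b = (2 `^ b) ^+ k.
Proof.
by rewrite -powR_mulrn // powRAC powR_mulrn ?powR_ge0.
Qed.

(** Layers x/2^(k+1) < s - 1/2 <= x/2^k shrinking to the endpoint; the ratio is 2^(b - alpha), below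
    1 because b < alpha. *)
Lemma integral_powR_near (b x : R) : 0 < b -> b < alpha -> 0 < x ->
  (\int[nu]_(s in D)
      ((s - 2^-1) `^ (- b) * \1_(`]2^-1, 2^-1 + x]%classic : set R) s)%:E
   <= (C0 * 2 `^ b / (1 - 2 `^ (b - alpha)) * x `^ (alpha - b))%:E)%E.
Proof.
move=> b0 ba x0.
have P (n : nat) : 0 < (2 ^+ n : R) by exact: exprn_gt0.
rewrite mulrAC -[C0 * _ * _]mulrA.
apply: (@layered_integral_le _ (fun k => (x / 2 ^+ k.+1) `^ (- b))
  (fun k => x / 2 ^+ k)) => //.
- apply: measurable_funM; first exact: measurable_powR_shift.
  by apply: measurable_indic; exact: measurable_itv.
- by move=> s _; rewrite mulr_ge0 ?powR_ge0.
- by move=> k; exact: powR_ge0.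
- by move=> k; rewrite divr_gt0.
- rewrite -[ltRHS](@powRr0 _ 2) /powR pnatr_eq0 /= ltr_expR ltr_pM2r ?subr_lt0
    //.
  by rewrite ln_gt0 // ltr1n.
- move=> k; rewrite !powRM ?invr_ge0 ?(ltW x0) ?(ltW (P _)) //.
  have V (n : nat) (c : R) : (2 ^+ n : R)^-1 `^ c = (2 `^ (- c)) ^+ n.
    by rewrite -powR_inv1 ?ltW // -powRrM mulN1r powR2X.
  rewrite !V opprK exprS (@powRDpos _ alpha) // (@powRDpos _ b) // exprMn.
  by rewrite le_eqVlt; apply/orP; left; apply/eqP; ring.
- move=> s; rewrite half_lineE => Ds; rewrite indicE.
  have [/set_mem|_] := boolP (s \in _); last by left; rewrite mulr0.
  rewrite /= in_itv /= mulr1 => /andP[_ sx]; right.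
  have [||k /andP[k1 k2]] := @dyadic_down x (s - 2^-1); [lra|lra|].
  exists k; first lra.
  by apply: powR_inv_le; [exact: ltW|rewrite divr_gt0|exact: ltW].
Qed.

(** Layers x 2^k < s - 1/2 <= x 2^(k+1) moving away from the endpoint; the ratio is now 2^(alpha -
    c). *)
Lemma integral_powR_far (c x : R) : alpha < c -> 0 < x ->
  (\int[nu]_(s in D)
      ((s - 2^-1) `^ (- c) * \1_(`]2^-1 + x, +oo[%classic : set R) s)%:E
   <= (C0 * 2 `^ alpha / (1 - 2 `^ (alpha - c)) * x `^ (alpha - c))%:E)%E.
Proof.
move=> ac x0.
have P (n : nat) : 0 < (2 ^+ n : R) by exact: exprn_gt0.
rewrite mulrAC -[C0 * _ * _]mulrA.
apply: (@layered_integral_le _ (fun k => (x * 2 ^+ k) `^ (- c))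
  (fun k => x * 2 ^+ k.+1)) => //.
- apply: measurable_funM; first exact: measurable_powR_shift.
  by apply: measurable_indic; exact: measurable_itv.
- by move=> s _; rewrite mulr_ge0 ?powR_ge0.
- by move=> k; exact: powR_ge0.
- by move=> k; rewrite mulr_gt0.
- rewrite -[ltRHS](@powRr0 _ 2) /powR pnatr_eq0 /= ltr_expR ltr_pM2r ?subr_lt0
    //.
  by rewrite ln_gt0 // ltr1n.
- move=> k; rewrite !powRM ?(ltW x0) ?(ltW (P _)) // !powR2X exprS.
  rewrite !(@powRDpos _ alpha) // exprMn.
  by rewrite le_eqVlt; apply/orP; left; apply/eqP; ring.
- move=> s; rewrite half_lineE => Ds; rewrite indicE.
  have [/set_mem|_] := boolP (s \in _); last by left; rewrite mulr0.
  rewrite /= in_itv /= mulr1 andbT => sx; right.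
  have [||k /andP[k1 k2]] := @dyadic_up x (s - 2^-1); [lra|lra|].
  exists k; first lra.
  by apply: powR_inv_le; [exact/ltW/(lt_trans alpha_gt0)|rewrite
    mulr_gt0|exact: ltW].
Qed.

(** Layers of width 1/L: on the k-th one the integrand is at most e^(-k), while the measure up to
    its right end is at most C0 ((k + 1)/L)^alpha. Half of the exponential absorbs the power of k +
    1, leaving the ratio e^(-1/2). *)
Lemma integral_expR_le (L : R) : 0 < L ->
  (\int[nu]_(s in D) (expR (- ((s - 2^-1) * L)))%:E
   <= (C0 * ((2 * alpha) `^ alpha * expR 2^-1 * L `^ (- alpha))
       / (1 - expR (- 2^-1)))%:E)%E.
Proof.
move=> L0.
apply: (@layered_integral_le _ (fun k => expR (- k%:R)) (fun k => k.+1%:R / L)).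
- apply: measurableT_comp; first exact: measurable_expR.
  apply: measurableT_comp => //; apply: measurable_funM => //.
  exact: measurable_funB.
- by move=> s _; exact: expR_ge0.
- by move=> k; exact: expR_ge0.
- by move=> k; rewrite divr_gt0.
- exact: expR_ge0.
- by rewrite -expR0 ltr_expR oppr_lt0 invr_gt0.
- move=> k; rewrite (@powRM _ k.+1%:R) ?invr_ge0 ?(ltW L0) //.
  rewrite -[L^-1]powR_inv1 ?(ltW L0) // -[(L `^ _) `^ _]powRrM mulN1r.
  have a20 : 0 < 2 * alpha by rewrite mulr_gt0.
  (* This is u <= e^u at u = (k + 1)/(2 alpha), raised to the power alpha. *)
  have : k.+1%:R `^ alpha <= (2 * alpha) `^ alpha * expR (2^-1 * k.+1%:R) :> R.
    have -> : expR (2^-1 * k.+1%:R) =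
      (expR (k.+1%:R / (2 * alpha))) `^ alpha :> R.
      rewrite /powR (negbTE (lt0r_neq0 (expR_gt0 _))) expRK; congr expR.
      by rewrite invfM; field; rewrite lt0r_neq0.
    rewrite -powRM ?expR_ge0 ?(ltW a20) //.
    apply: ge0_ler_powR; rewrite ?nnegrE ?mulr_ge0 ?expR_ge0 ?(ltW a20) ?(ltW
      alpha_gt0) //.
    rewrite mulrC -ler_pdivrMr //.
    by apply: le_trans (expR_ge1Dx _); rewrite lerDr.
  move=> /(ler_wpM2l (expR_ge0 (- k%:R))).
  have -> : expR (- k%:R) * ((2 * alpha) `^ alpha * expR (2^-1 * k.+1%:R))
     = (2 * alpha) `^ alpha * expR 2^-1 * expR (- 2^-1) ^+ k :> R.
    rewrite mulrCA -mulrA -expRM_natl -!expRD; congr (_ * expR _).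
    by rewrite -natr1; field.
  move=> /(ler_wpM2r (powR_ge0 L (- alpha))); rewrite -[leLHS]mulrA.
  by move/le_trans; apply; rewrite le_eqVlt; apply/orP; left; apply/eqP; ring.
- move=> s; rewrite half_lineE => Ds; right.
  have y0 : 0 <= (s - 2^-1) * L by rewrite mulr_ge0 ?(ltW L0) // subr_ge0 ltW.
  exists (Num.truncn ((s - 2^-1) * L)).
    rewrite -lerBlDl ler_pdivlMr //; exact/ltW/truncnS_gt.
  by rewrite ler_expR lerN2 truncn_le.
Qed.

(** The exponent of the Schur weight. What counts is 0 < b < alpha: b is then admissible in the near
    estimate and alpha + b in the far one. *)
Let b := alpha / 2.
Let b_gt0 : 0 < b. Proof. by rewrite /b divr_gt0. Qed.
Let b_lt : b < alpha. Proof. by rewrite /b; have := alpha_gt0; lra. Qed.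

(** Put y = s - 1/2 and split at y = x. For y <= x the kernel (y + x)^(-alpha) is at most
    x^(-alpha), for y > x at most y^(-alpha). The near estimate with exponent b and the far one with
    alpha + b both yield order x^(-b). *)
Lemma integral_schur_kernel : exists2 K : R, 0 <= K &
  forall x : R, 0 < x ->
  (\int[nu]_(s in D) ((s - 2^-1 + x) `^ (- alpha) * (s - 2^-1) `^ (- b))%:E
   <= (K * x `^ (- b))%:E)%E.
Proof.
pose K1 := C0 * 2 `^ b / (1 - 2 `^ (b - alpha)).
pose K2 := C0 * 2 `^ alpha / (1 - 2 `^ (alpha - (alpha + b))).
have main x : 0 < x ->
  (\int[nu]_(s in D) ((s - 2^-1 + x) `^ (- alpha) * (s - 2^-1) `^ (- b))%:E
   <= ((K1 + K2) * x `^ (- b))%:E)%E.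
  move=> x0.
  pose f1 (s : R) := (s - 2^-1) `^ (- b) * \1_(`]2^-1, 2^-1 + x]%classic : set
    R) s.
  pose f2 (s : R) :=
    (s - 2^-1) `^ (- (alpha + b)) * \1_(`]2^-1 + x, +oo[%classic : set R) s.
  have mf1 : measurable_fun D f1.
    apply: measurable_funM; first exact: measurable_powR_shift.
    by apply: measurable_indic; exact: measurable_itv.
  have mf2 : measurable_fun D f2.
    apply: measurable_funM; first exact: measurable_powR_shift.
    by apply: measurable_indic; exact: measurable_itv.
  have f10 s : 0 <= f1 s by rewrite mulr_ge0 ?powR_ge0.
  have f20 s : 0 <= f2 s by rewrite mulr_ge0 ?powR_ge0.
  apply: (@le_trans _ _ (\int[nu]_(s in D) ((x `^ (- alpha))%:E * (f1 s)%:E +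
    (f2 s)%:E))%E).
    apply: ge0_le_integral => //.
    - by move=> s _; rewrite lee_fin mulr_ge0 ?powR_ge0.
    - apply/measurable_EFinP; apply: measurable_funM;
        last exact: measurable_powR_shift.
      under eq_fun do rewrite -addrA; exact: measurable_powR_shift.
    - apply/measurable_EFinP; apply: measurable_funD => //.
      by apply: measurable_funM.
    - move=> s; rewrite half_lineE => Ds; rewrite -EFinM -EFinD lee_fin /f1 /f2.
      have [sx|sx] := leP s (2^-1 + x).
        rewrite !indicE mem_set /=; last by rewrite in_itv /= Ds.
        rewrite memNset /=; last by rewrite in_itv /= andbT; apply/negP;
          rewrite -leNgt.
        rewrite mulr1 mulr0 addr0; apply: ler_wpM2r; first exact: powR_ge0.
        by apply: powR_inv_le; have := alpha_gt0; have := b_gt0; lra.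
      rewrite !indicE memNset /=; last by rewrite in_itv /= Ds /=; apply/negP;
        rewrite -ltNge.
      rewrite mem_set /=; last by rewrite in_itv /= andbT.
      rewrite mulr1 !mulr0 add0r opprD powRDpos; last lra.
      by apply: ler_wpM2r; [exact: powR_ge0|apply: powR_inv_le;
        have := alpha_gt0; lra].
  have m1 : measurable_fun D (fun s => (x `^ (- alpha))%:E * (f1 s)%:E)%E.
    by apply/measurable_EFinP; apply: measurable_funM.
  have m2 : measurable_fun D (EFin \o f2) by exact/measurable_EFinP.
  have p1 s : D s -> (0 <= (x `^ (- alpha))%:E * (f1 s)%:E)%E.
    by move=> _; rewrite -EFinM lee_fin mulr_ge0 ?powR_ge0.
  have q1 s : D s -> (0 <= (f1 s)%:E)%E by rewrite lee_fin.
  have q2 s : D s -> (0 <= (f2 s)%:E)%E by rewrite lee_fin.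
  rewrite ge0_integralD //.
  rewrite ge0_integralZl_EFin ?powR_ge0 //; last exact/measurable_EFinP.
  have := integral_powR_near _ _ b_gt0 b_lt x0; rewrite -/K1 => H1.
  have abb : alpha < alpha + b by rewrite ltrDl.
  have := integral_powR_far _ _ abb x0; rewrite -/K2 => H2.
  have x10 : (0 <= (x `^ (- alpha))%:E)%E by rewrite lee_fin powR_ge0.
  apply: le_trans (leeD (lee_wpmul2l x10 H1) H2) _.
  rewrite -EFinM -EFinD lee_fin mulrDl lerD //.
    by rewrite mulrCA -powRDpos // addrA addNr add0r.
  by rewrite opprD addrA subrr add0r.
(* The sign of the constant is read off from the estimate at x = 1, whose left side is
   nonnegative. *)
exists (K1 + K2) => //.
have := main 1 ltr01; rewrite powR1 mulr1; rewrite -lee_fin; apply: le_trans.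
by apply: integral_ge0 => s _; rewrite lee_fin mulr_ge0 ?powR_ge0.
Qed.

(** Schur test function for the kernel 1 + (s + t - 1)^(-alpha). The power handles the singularity
    at the endpoint; the summand 1 keeps the weight bounded below for large s, where the kernel does
    not decay. *)
Definition schur_weight (s : R) : R := 1 + (s - 2^-1) `^ (- b).
Local Notation h := schur_weight.

Lemma schur_weight_ge1 s : 1 <= h s.
Proof. by rewrite lerDl powR_ge0. Qed.

Lemma measurable_schur_weight : measurable_fun D h.
Proof.
by apply: measurable_funD => //; exact: measurable_powR_shift.
Qed.

(** The near estimate covers s - 1/2 <= 1; beyond that the integrand is at most 1 and the measure is
    finite. *)
Lemma integral_powR_lty : (\int[nu]_(s in D) ((s - 2^-1) `^ (- b))%:E < +oo)%E.
Proof.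
pose f1 (s : R) := (s - 2^-1) `^ (- b) * \1_(`]2^-1, 2^-1 + 1]%classic : set R)
  s.
have mf1 : measurable_fun D f1.
  apply: measurable_funM; first exact: measurable_powR_shift.
  by apply: measurable_indic; exact: measurable_itv.
apply: (@le_lt_trans _ _ (\int[nu]_(s in D) ((f1 s)%:E + 1))%E).
  apply: ge0_le_integral => //.
  - by move=> s _; rewrite lee_fin powR_ge0.
  - apply/measurable_EFinP; exact: measurable_powR_shift.
  - by apply/measurable_EFinP; apply: measurable_funD.
  - move=> s; rewrite half_lineE => Ds; rewrite -EFinD lee_fin /f1 indicE.
    have [sx|sx] := leP s (2^-1 + 1).
      by rewrite mem_set /= ?mulr1 ?lerDl // in_itv /= Ds.
    rewrite memNset /= ?mulr0 ?add0r; last by rewrite in_itv /= Ds /=;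
      apply/negP; rewrite -ltNge.
    by rewrite -[leRHS](powR1r (- b)); apply: powR_inv_le; have := alpha_gt0;
      have := b_gt0; lra.
have m1 : measurable_fun D (EFin \o f1) by exact/measurable_EFinP.
have p1 s : D s -> (0 <= (f1 s)%:E)%E by rewrite lee_fin mulr_ge0 ?powR_ge0.
rewrite ge0_integralD //.
apply: lte_add_pinfty.
  by apply: le_lt_trans (integral_powR_near _ _ b_gt0 b_lt ltr01) _;
    rewrite ltry.
by rewrite integral_cst // mul1e -ge0_fin_numE ?fin_num_measure.
Qed.

Lemma schur_weight_kernel : exists2 K : R, 0 <= K & forall s, D s ->
  (\int[nu]_(t in D) ((1 + (s + t - 1) `^ (- alpha)) * h t)%:E
   <= (K * h s)%:E)%E.
Proof.
have [K K0 HK] := integral_schur_kernel.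
pose V := fine (nu D).
have nuV : nu D = V%:E by rewrite fineK ?fin_num_measure.
have V0 : 0 <= V by rewrite fine_ge0.
pose W := fine (\int[nu]_(s in D) ((s - 2^-1) `^ (- b))%:E).
have WW0 : (0 <= \int[nu]_(s in D) ((s - 2^-1) `^ (- b))%:E)%E.
  by apply: integral_ge0 => s _; rewrite lee_fin powR_ge0.
have intW : (\int[nu]_(s in D) ((s - 2^-1) `^ (- b))%:E)%E = W%:E.
  by rewrite fineK // ge0_fin_numE // integral_powR_lty.
have W0 : 0 <= W by rewrite fine_ge0.
exists (2 * V + W + 2 * K) => [|s]; first by rewrite !addr_ge0 ?mulr_ge0.
rewrite half_lineE => Ds.
have x0 : 0 < s - 2^-1 by rewrite subr_gt0.
pose f1 (t : R) := (t - 2^-1) `^ (- b).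
pose f2 (t : R) := (t - 2^-1 + (s - 2^-1)) `^ (- alpha) * (t - 2^-1) `^ (- b).
have mf1 : measurable_fun D f1 by exact: measurable_powR_shift.
have mf2 : measurable_fun D f2.
  apply: measurable_funM => //.
  by rewrite /f2; under eq_fun do rewrite -addrA; exact: measurable_powR_shift.
have f10 t : 0 <= f1 t by rewrite powR_ge0.
have f20 t : 0 <= f2 t by rewrite mulr_ge0 ?powR_ge0.
have est t : D t -> (1 + (s + t - 1) `^ (- alpha)) * h t <=
  2 + (f1 t + 2 * f2 t).
  rewrite half_lineE => Dt.
  have -> : s + t - 1 = t - 2^-1 + (s - 2^-1) by lra.
  rewrite /h -/(f1 t); have -> : f2 t =
    (t - 2^-1 + (s - 2^-1)) `^ (- alpha) * f1 t by [].
  set k := (_ `^ (- alpha)).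
  have k0 : 0 <= k by exact: powR_ge0.
  (* The only term of the expanded product (1 + k)(1 + f1) without a bound at hand is k alone. If t
     - 1/2 <= 1 then f1 >= 1 and k <= k f1; otherwise k <= 1. *)
  have : k <= 1 + k * f1 t.
    have [t1|t1] := leP (t - 2^-1) 1.
      have : 1 <= f1 t.
        by rewrite -[leLHS](powR1r (- b)); apply: powR_inv_le;
          have := alpha_gt0; have := b_gt0; lra.
      move=> f11; have := ler_wpM2l k0 f11; lra.
    have : k <= 1.
      by rewrite -[leRHS](powR1r (- alpha)); apply: powR_inv_le;
        have := alpha_gt0; have := b_gt0; lra.
    have := mulr_ge0 k0 (f10 t); lra.
  have := f10 t; nra.
apply: (@le_trans _ _ (\int[nu]_(t in D) (2%:E + ((f1 t)%:E + 2%:E * (f2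
  t)%:E)))%E).
  apply: ge0_le_integral => //.
  - by move=> t _; rewrite lee_fin mulr_ge0 ?addr_ge0 ?powR_ge0.
  - apply/measurable_EFinP; apply: measurable_funM;
      last exact: measurable_schur_weight.
    apply: measurable_funD => //.
    under eq_fun do rewrite (addrC s) -addrA; exact: measurable_powR_shift.
  - by apply/measurable_EFinP; do !apply: measurable_funD => //;
      apply: measurable_funM.
have m2 : measurable_fun D (fun t => (f1 t)%:E + 2%:E * (f2 t)%:E)%E.
  by apply/measurable_EFinP; apply: measurable_funD => //;
    apply: measurable_funM.
have p2 t : D t -> (0 <= (f1 t)%:E + 2%:E * (f2 t)%:E)%E.
  by move=> _; rewrite adde_ge0 ?mule_ge0 ?lee_fin ?f10 ?f20.
have m1 : measurable_fun D (EFin \o f1) by exact/measurable_EFinP.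
have m3 : measurable_fun D (fun t => 2%:E * (f2 t)%:E)%E.
  by apply/measurable_EFinP; apply: measurable_funM.
have p3 t : D t -> (0 <= 2%:E * (f2 t)%:E)%E.
  by move=> _; rewrite mule_ge0 ?lee_fin ?f20.
have q1 s0 : D s0 -> (0 <= (f1 s0)%:E)%E by rewrite lee_fin.
have q2 s0 : D s0 -> (0 <= (f2 s0)%:E)%E by rewrite lee_fin.
rewrite ge0_integralD // ge0_integralD //.
rewrite ge0_integralZl_EFin //; last exact/measurable_EFinP.
have -> : (\int[nu]_(_ in D) 2%:E = (2 * V)%:E)%E.
  by rewrite integral_cst // EFinM; congr (_ * _)%E; exact: nuV.
rewrite intW.
apply: (@le_trans _ _ ((2 * V)%:E + (W%:E + 2%:E * (K * (s - 2^-1) `^ (-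
  b))%:E))%E).
  by rewrite leeD2l // leeD2l // lee_wpmul2l // HK.
rewrite -EFinM -!EFinD lee_fin /h; have := powR_ge0 (s - 2^-1) (- b); nra.
Qed.

End Growth.

(** * Size and monotonicity of zeta^alpha to the right of 1 *)

Section ZetaPowRBounds.
Context {R : realType}.
Variables (alpha : R) (d : nat -> R).
Hypothesis alpha_gt0 : 0 < alpha.
Hypothesis hd : zeta_power_coeffs alpha d.

Lemma dpsum_le_zeta_powR (x : R) N : 1 < x -> dpsum d x N <= zeta_powR alpha x.
Proof.
move=> x1; have c := zeta_powR_cvg _ _ hd _ x1.
rewrite -(cvg_lim (@Rhausdorff R) c); apply: nondecreasing_cvgn_le.
  by apply: dpsum_nondecreasing => n n1; apply/ltW/hd.1.
by apply/cvg_ex; eexists; exact: c.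
Qed.

Lemma zeta_powR_le (x : R) : 1 < x ->
  zeta_powR alpha x <= 2 `^ alpha * (1 + (x - 1) `^ (- alpha)).
Proof.
move=> x1; have e0 : 0 < x - 1 by rewrite subr_gt0.
have /andP[z1 z2] := zeta_bounds _ e0.
move: z1 z2; have -> : 1 + (x - 1) = x by lra.
move=> z1 z2.
have z0 : 0 <= complex.Re (zeta x%:C).
  by apply: le_trans z1; rewrite invr_ge0 mulr_ge0 // ltW.
rewrite /zeta_powR.
(* Used with y the larger of 1 and 1/(x - 1), since zeta(x) <= 1 + 1/(x - 1) <= 2 y. *)
have H (y : R) : 0 <= y -> complex.Re (zeta x%:C) <= 2 * y ->
    y `^ alpha <= 1 + (x - 1) `^ (- alpha) ->
    complex.Re (zeta x%:C) `^ alpha <= 2 `^ alpha * (1 + (x - 1) `^ (- alpha)).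
  move=> y0 zy yH.
  apply: (@le_trans _ _ ((2 * y) `^ alpha)).
    by apply: ge0_ler_powR; rewrite ?nnegrE ?mulr_ge0 // ltW.
  by rewrite powRM // ler_wpM2l ?powR_ge0.
have [x2|x2] := leP 1 (x - 1)^-1.
  apply: (H (x - 1)^-1); [by rewrite invr_ge0 ltW|lra|].
  by rewrite -powR_inv1 ?(ltW e0) // -powRrM mulN1r lerDr.
by apply: (H 1); [lra|lra|rewrite powR1r lerDl powR_ge0].
Qed.

Lemma zeta_powR_ge (e : R) : 0 < e ->
  (2 * e) `^ (- alpha) <= zeta_powR alpha (1 + e).
Proof.
move=> e0; have /andP[z1 _] := zeta_bounds _ e0.
have e20 : 0 < 2 * e by rewrite mulr_gt0.
rewrite /zeta_powR -mulN1r powRrM powR_inv1 ?(ltW e20) //.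
apply: ge0_ler_powR (z1); rewrite ?nnegrE ?invr_ge0 ?(ltW e20) ?(ltW alpha_gt0)
  //.
by apply: le_trans z1; rewrite invr_ge0 ltW.
Qed.

(** The coefficients are positive, so every partial sum at y is at most the one at x, hence at most
    the limit at x. *)
Lemma zeta_powR_le_mono (x y : R) : 1 < x -> x <= y ->
  zeta_powR alpha y <= zeta_powR alpha x.
Proof.
move=> x1 xy; have y1 := lt_le_trans x1 xy.
have c := zeta_powR_cvg _ _ hd _ y1.
rewrite -(cvg_lim (@Rhausdorff R) c); apply: limr_le.
  by apply/cvg_ex; eexists; exact: c.
apply: nearW => N; apply: le_trans (dpsum_le_zeta_powR _ N x1).
apply: ler_sum => n _; apply: ler_wpM2l; first exact/ltW/hd.1.
by apply: ler_powR; rewrite ?ler1n // lerN2.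
Qed.

End ZetaPowRBounds.

(** * The functions s -> n^(-s): measurability, integrability, finite sums under the integral *)

Section NatPow.
Context {R : realType}.
Variable nu : {finite_measure set R -> \bar R}.
Local Notation D := (@half_line R).
Let mD := @measurable_half_line R.

Lemma measurable_natpow (A : set R) n :
  measurable_fun A (fun s : R => n.+1%:R `^ (- s)).
Proof.
rewrite /powR; under eq_fun do rewrite pnatr_eq0 /=.
apply: measurableT_comp; first exact: measurable_expR.
by apply: measurable_funM => //; exact: measurableT_comp.
Qed.

Lemma natpow_le1 n (s : R) : D s -> n.+1%:R `^ (- s) <= 1.
Proof.
rewrite half_lineE => Ds; rewrite -[leRHS](@powRr0 _ n.+1%:R).
by apply: ler_powR; rewrite ?ler1n //; lra.
Qed.

Lemma natpowM m n (s : R) :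
  (m.+1 * n.+1)%:R `^ s = m.+1%:R `^ s * n.+1%:R `^ s :> R.
Proof. by rewrite natrM powRM. Qed.

Lemma natpowD n (s t : R) :
  n.+1%:R `^ (- (s + t)) = n.+1%:R `^ (- s) * n.+1%:R `^ (- t).
Proof. by rewrite opprD powRDpos. Qed.

Lemma integrable_natpowM n (f : R -> R) : nu.-integrable D (EFin \o f) ->
  nu.-integrable D (EFin \o (fun s => n.+1%:R `^ (- s) * f s)).
Proof.
move=> fi; apply: le_integrable (fi) => //.
  apply/measurable_EFinP; apply: measurable_funM;
    first exact: measurable_natpow.
  exact/measurable_EFinP/measurable_int/fi.
move=> s Ds; rewrite /= lee_fin normrM ger0_norm ?powR_ge0 //.
by apply: ler_piMl => //; exact: natpow_le1.
Qed.

Lemma integrable_natpow n :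
  nu.-integrable D (EFin \o (fun s => n.+1%:R `^ (- s))).
Proof.
have := integrable_natpowM n (fun=> 1) (finite_measure_integrable_cst nu 1 mD).
by under [in X in X -> _]eq_fun do rewrite mulr1.
Qed.

Lemma integrable_rsum (f : nat -> R -> R) N :
  (forall n, nu.-integrable D (EFin \o f n)) ->
  nu.-integrable D (EFin \o (fun s => \sum_(0 <= n < N) f n s)).
Proof.
move=> fi.
apply: (@eq_integrable _ _ _ nu D mD (fun s => \sum_(0 <= n < N) (f n s)%:E)%E).
  by move=> s _ /=; rewrite sumEFin.
by apply: integrable_sum => // n _; exact: fi.
Qed.

Lemma integrable_rZl (c : R) (f : R -> R) : nu.-integrable D (EFin \o f) ->
  nu.-integrable D (EFin \o (fun s => c * f s)).
Proof.
move=> fi.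
apply: (@eq_integrable _ _ _ nu D mD (fun s => c%:E * (f s)%:E)%E).
  by move=> s _ /=; rewrite EFinM.
exact: integrableZl.
Qed.

Lemma Rintegral_sum (f : nat -> R -> R) N :
  (forall n, nu.-integrable D (EFin \o f n)) ->
  \int[nu]_(s in D) (\sum_(0 <= n < N) f n s) =
  \sum_(0 <= n < N) \int[nu]_(s in D) f n s.
Proof.
move=> fi; elim: N => [|N IH].
  under eq_Rintegral do rewrite big_geq //.
  by rewrite Rintegral_cst // mul0r big_geq.
under eq_Rintegral do rewrite big_nat_recr //=.
by rewrite RintegralD // ?IH ?big_nat_recr //; exact: integrable_rsum.
Qed.

Lemma Rintegral_le_bound (f g : R -> R) (c : R) :
  measurable_fun D f -> measurable_fun D g ->
  (forall s, D s -> 0 <= f s <= g s) ->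
  (\int[nu]_(s in D) (g s)%:E <= c%:E)%E ->
  \int[nu]_(s in D) f s <= c.
Proof.
move=> mf mg fg gc.
have fc : (\int[nu]_(s in D) (f s)%:E <= c%:E)%E.
  apply: le_trans gc; apply: ge0_le_integral => //; try exact/measurable_EFinP.
    by move=> s /fg /andP[? _]; rewrite lee_fin.
  by move=> s /fg /andP[_ ?]; rewrite lee_fin.
rewrite -lee_fin fineK // ge0_fin_numE; first exact: le_lt_trans fc (ltry _).
by apply: integral_ge0 => s /fg /andP[? _]; rewrite lee_fin.
Qed.

End NatPow.

(** * The Schur test for the Hankel matrix *)

Section DiscreteSchur.
Context {R : realType}.
Variables (nu : {finite_measure set R -> \bar R}) (alpha C0 : R) (d : nat -> R).
Hypothesis alpha_gt0 : 0 < alpha.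
Hypothesis C0_ge0 : 0 <= C0.
Hypothesis nu_growth : forall r : R, 0 < r ->
  (nu (`]2^-1, 2^-1 + r]%classic)%R <= (C0 * r `^ alpha)%:E)%E.
Hypothesis hd : zeta_power_coeffs alpha d.
Local Notation D := (@half_line R).
Let mD := @measurable_half_line R.
Local Notation h := (schur_weight alpha).

(** M_n of the overview, which for n >= 1 is [varrho d nu n / d n]. *)
Definition moment n : R := \int[nu]_(s in D) (n%:R `^ (- s)).

Let d_gt0 n : 0 < d n.+1. Proof. exact: hd.1. Qed.

Lemma integrable_schur_weight : nu.-integrable D (EFin \o h).
Proof.
apply: (@eq_integrable _ _ _ nu D mD
  ((EFin \o cst 1%R) \+ (fun s => ((s - 2^-1) `^ (- (alpha / 2)))%:E))%E).
  by move=> s _ /=; rewrite -EFinD.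
apply: integrableD => //; first exact: finite_measure_integrable_cst.
apply/integrableP; split; first by apply/measurable_EFinP;
  exact: measurable_powR_shift.
under eq_integral do rewrite gee0_abs ?lee_fin ?powR_ge0 //.
exact: (integral_powR_lty _ _ _ alpha_gt0 C0_ge0 nu_growth).
Qed.

(** p_(n+1) of the overview: index n stands for the integer n + 1, as in all the finite sums
    starting from 0. *)
Definition schur_vector n : R :=
  \int[nu]_(t in D) (n.+1%:R `^ (- t) * h t) + n.+1%:R `^ (- 2).

Lemma schur_vector_gt0 n : 0 < schur_vector n.
Proof.
apply: ltr_wpDl; last by rewrite powR_gt0.
apply: Rintegral_ge0 => t _; rewrite mulr_ge0 ?powR_ge0 //.
exact: le_trans ler01 (schur_weight_ge1 _ _).
Qed.

Lemma schur_vector_dpsum : exists2 K : R, 0 <= K & forall N s, D s ->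
  \sum_(0 <= n < N) d n.+1 * schur_vector n * n.+1%:R `^ (- s) <= K * h s.
Proof.
have [K K0 HK] := schur_weight_kernel _ _ _ alpha_gt0 C0_ge0 nu_growth.
have a20 : 0 <= 2 `^ alpha :> R by exact: powR_ge0.
exists (2 `^ alpha * K + 2 `^ alpha * 2) => [|N s Ds].
  by rewrite addr_ge0 ?mulr_ge0.
have s12 : 2^-1 < s by rewrite -half_lineE.
have h1 := schur_weight_ge1 alpha s.
(* Exchanging sum and integral turns the two summands of p_n into truncated zeta powers, at s + t
   and at s + 2. The first is controlled by [schur_weight_kernel]. *)
have -> : \sum_(0 <= n < N) d n.+1 * schur_vector n * n.+1%:R `^ (- s) =
   \int[nu]_(t in D) (dpsum d (s + t) N * h t) + dpsum d (s + 2) N.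
  have -> : \int[nu]_(t in D) (dpsum d (s + t) N * h t) =
     \int[nu]_(t in D) (\sum_(0 <= n < N)
        (d n.+1 * n.+1%:R `^ (- s)) * (n.+1%:R `^ (- t) * h t)).
    apply: eq_Rintegral => t _; rewrite /dpsum mulr_suml; apply: eq_bigr => n _.
    by rewrite natpowD; ring.
  rewrite Rintegral_sum; last first.
    by move=> n;
      apply/integrable_rZl/integrable_natpowM/integrable_schur_weight.
  rewrite /dpsum -big_split /=; apply: eq_bigr => n _.
  rewrite RintegralZl //; last exact/integrable_natpowM/integrable_schur_weight.
  by rewrite natpowD /schur_vector; ring.
rewrite mulrDl; apply: lerD.
  apply: (@Rintegral_le_bound _ nu _
    (fun t => 2 `^ alpha * ((1 + (s + t - 1) `^ (- alpha)) * h t))).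
  - apply: measurable_funM; last exact: measurable_schur_weight.
    apply: measurable_sum => n; apply: measurable_funM => //.
    under eq_fun do rewrite natpowD.
    by apply: measurable_funM => //; exact: measurable_natpow.
  - apply: measurable_funM => //; apply: measurable_funM;
      last exact: measurable_schur_weight.
    apply: measurable_funD => //.
    under eq_fun do rewrite (addrC s) -addrA; exact: measurable_powR_shift.
  - move=> t; rewrite half_lineE => Dt.
    have ht := le_trans ler01 (schur_weight_ge1 alpha t).
    rewrite mulr_ge0 //=; last by apply: sumr_ge0 => n _;
      rewrite mulr_ge0 ?powR_ge0 // ltW.
    rewrite mulrA; apply: ler_wpM2r => //.
    have st : 1 < s + t by lra.
    exact: le_trans (dpsum_le_zeta_powR _ _ hd _ _ st) (zeta_powR_le _
      alpha_gt0 _ st).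
  - under eq_integral do rewrite EFinM.
    have p1 t : D t -> (0 <= ((1 + (s + t - 1) `^ (- alpha)) * h t)%:E)%E.
      move=> _; rewrite lee_fin mulr_ge0 ?addr_ge0 ?powR_ge0 //.
    have m1 : measurable_fun D
        (EFin \o (fun t => (1 + (s + t - 1) `^ (- alpha)) * h t)).
      apply/measurable_EFinP; apply: measurable_funM;
        last exact: measurable_schur_weight.
      apply: measurable_funD => //.
      under eq_fun do rewrite (addrC s) -addrA; exact: measurable_powR_shift.
    rewrite ge0_integralZl_EFin // -mulrA EFinM.
    exact: lee_wpmul2l (HK _ Ds).
(* The term from n^(-2) stays away from the pole, as s + 2 - 1 >= 1: it is at most 2^alpha times 2,
   and the weight is at least 1. *)
have st : 1 < s + 2 by lra.
apply: le_trans (dpsum_le_zeta_powR _ _ hd _ _ st) _.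
apply: le_trans (zeta_powR_le _ alpha_gt0 _ st) _.
rewrite -mulrA; apply: ler_wpM2l => //.
have : (s + 2 - 1) `^ (- alpha) <= 1.
  by rewrite -[leRHS](powR1r (- alpha)); apply: powR_inv_le;
    [exact: ltW|lra|lra].
lra.
Qed.

(** Integrate [schur_vector_dpsum] against m^(-s): the integral of m^(-s) h(s) on the right is the
    first summand of p_m. *)
Lemma moment_schur : exists2 K : R, 0 <= K & forall N m,
  \sum_(0 <= n < N) d n.+1 * schur_vector n * moment (m.+1 * n.+1)
  <= K * schur_vector m.
Proof.
have [K K0 HK] := schur_vector_dpsum.
exists K => // N m.
have -> : \sum_(0 <= n < N) d n.+1 * schur_vector n * moment (m.+1 * n.+1) =
  \int[nu]_(s in D) (\sum_(0 <= n < N)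
    d n.+1 * schur_vector n * (m.+1%:R `^ (- s) * n.+1%:R `^ (- s))).
  rewrite Rintegral_sum; last first.
    by move=> n; apply/integrable_rZl/integrable_natpowM/integrable_natpow.
  apply: eq_bigr => n _; rewrite RintegralZl //;
    last exact/integrable_natpowM/integrable_natpow.
  by congr (_ * _); apply: eq_Rintegral => s _; rewrite natpowM.
apply: (@le_trans _ _ (\int[nu]_(s in D) (K * (m.+1%:R `^ (- s) * h s)))).
  apply: le_Rintegral => //.
  - by apply: integrable_rsum => n;
      apply/integrable_rZl/integrable_natpowM/integrable_natpow.
  - exact/integrable_rZl/integrable_natpowM/integrable_schur_weight.
  - move=> s Ds; rewrite mulrCA.
    under eq_bigr do rewrite mulrCA.
    rewrite -mulr_sumr; apply: ler_wpM2l; first exact: powR_ge0.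
    exact: HK.
rewrite RintegralZl //; last exact/integrable_natpowM/integrable_schur_weight.
by apply: ler_wpM2l => //; rewrite lerDl powR_ge0.
Qed.

(** Schur test in the form of a weighted arithmetic-geometric mean inequality: with w_n = d_n p_n, 2
    x_m y_n <= l x_m^2 w_n/w_m + (1/l) y_n^2 w_m/w_n. Summing against M_(mn) and using
    [moment_schur] turns x_m^2/w_m into K x_m^2/d_m. The parameter l stays free so that optimizing
    it later gives a product of norms. *)
Lemma moment_quadratic_form : exists2 K : R, 0 <= K &
  forall N (x y : nat -> R) (l : R), 0 < l ->
  2 * \sum_(0 <= m < N) \sum_(0 <= n < N) x m * y n * moment (m.+1 * n.+1)
  <= K * (l * \sum_(0 <= m < N) x m ^+ 2 / d m.+1
          + l^-1 * \sum_(0 <= n < N) y n ^+ 2 / d n.+1).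
Proof.
have [K K0 HK] := moment_schur.
exists K => // N x y l l0.
pose w n := d n.+1 * schur_vector n.
have w0 n : 0 < w n by rewrite mulr_gt0 ?schur_vector_gt0.
have M0 n : 0 <= moment n by apply: Rintegral_ge0 => s _; exact: powR_ge0.
have side (z : nat -> R) :
  \sum_(0 <= m < N) \sum_(0 <= n < N) z m ^+ 2 / w m * (w n * moment (m.+1 *
    n.+1))
  <= K * \sum_(0 <= m < N) z m ^+ 2 / d m.+1.
  rewrite mulr_sumr; apply: ler_sum => m _; rewrite -mulr_sumr.
  apply: (@le_trans _ _ (z m ^+ 2 / w m * (K * schur_vector m))).
    by apply: ler_wpM2l; [rewrite divr_ge0 ?sqr_ge0 // ltW|exact: HK].
  rewrite le_eqVlt; apply/orP; left; apply/eqP; rewrite /w.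
  by field; rewrite !lt0r_neq0 ?schur_vector_gt0.
have sx := side x; have sy := side y.
(* The same bound with the roles of m and n exchanged, by symmetry of M_(mn). *)
have sy' : \sum_(0 <= m < N) \sum_(0 <=
  n < N) y n ^+ 2 / w n * (w m * moment (m.+1 * n.+1))
  <= K * \sum_(0 <= m < N) y m ^+ 2 / d m.+1.
  apply: le_trans sy; rewrite exchange_big /= le_eqVlt; apply/orP; left;
    apply/eqP.
  by apply: eq_bigr => m _; apply: eq_bigr => n _; rewrite mulnC.
have l0' : 0 < l^-1 by rewrite invr_gt0.
rewrite mulrDr mulrCA (mulrCA K l^-1).
apply: le_trans (lerD (ler_wpM2l (ltW l0) sx) (ler_wpM2l (ltW l0') sy')).
rewrite !mulr_sumr -big_split /=; apply: ler_sum => m _.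
rewrite !mulr_sumr -big_split /=; apply: ler_sum => n _.
rewrite !mulrA -mulrDl; apply: ler_wpM2r => //.
(* The difference of the two sides of the weighted inequality is a perfect square over l w_m w_n. *)
rewrite -subr_ge0
  (_ : _ - _ = (l * x m * w n - y n * w m) ^+ 2 / (l * w m * w n)); last first.
  by rewrite /w; field; rewrite !lt0r_neq0 ?schur_vector_gt0.
apply: divr_ge0; first exact: sqr_ge0.
by apply/ltW/mulr_gt0; [apply: mulr_gt0|].
Qed.

End DiscreteSchur.

(** * Hankel form and norm on finitely supported sequences as finite sums *)

Section HankelFinite.
Context {R : realType}.
Variables (nu : {finite_measure set R -> \bar R}) (d : nat -> R).
Hypothesis d_gt0 : forall n, (1 <= n)%N -> 0 < d n.
Implicit Types a b : nat -> R[i].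

Lemma fsbig_positive_nat (F : nat -> R[i]) N :
  (forall n, (N < n)%N -> F n = 0) ->
  \sum_(n \in [set n | (1 <= n)%N]) F n = \sum_(0 <= n < N) F n.+1.
Proof.
move=> F0; rewrite (fsbigE (iota 1 N)) ?iota_uniq //.
- rewrite big_seq_cond (eq_bigl (fun i => i \in iota 1 N)); last first.
    move=> i; case: (boolP (i \in iota 1 N)) => //=.
    by rewrite mem_iota => /andP[i1 _]; rewrite mem_set.
  by rewrite -big_seq (_ : iota 1 N =
    index_iota 1 N.+1) ?big_add1 // /index_iota subn1.
- by move=> i /=; rewrite mem_iota => /andP[].
- move=> i /= i1; rewrite mem_iota i1 /= add1n ltnS -ltnNge; exact: F0.
Qed.

Lemma hankel_form_truncate a b N :
  (forall n, (N < n)%N -> a n = 0) -> (forall n, (N < n)%N -> b n = 0) ->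
  hankel_form (fun n => (varrho d nu n)%:C) d a b =
  \sum_(0 <= m < N) \sum_(0 <= n < N)
     a m.+1 * b n.+1 * (moment nu (m.+1 * n.+1))%:C.
Proof.
move=> a0 b0; rewrite /hankel_form (fsbig_positive_nat _ N); last first.
  by move=> m /a0 ->; rewrite fsbig1 // => n _; rewrite !mul0r.
apply: eq_bigr => m _; rewrite (fsbig_positive_nat _ N); last first.
  by move=> n /b0 ->; rewrite mulr0 mul0r.
apply: eq_bigr => n _; congr (_ * _); rewrite -[RHS]mulr1.
have dmn : (d (m.+1 * n.+1)%N)%:C != 0 :> R[i].
  by rewrite (inj_eq (@complexI R)) lt0r_neq0 // d_gt0.
by rewrite /varrho rmorphM /= mulrAC divff // mul1r mulr1.
Qed.

Lemma l2norm_truncate a N : (forall n, (N < n)%N -> a n = 0) ->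
  l2norm d a = Num.sqrt (\sum_(0 <= n < N) cabs (a n.+1) ^+ 2 / d n.+1).
Proof.
move=> a0; congr Num.sqrt.
rewrite (_ : (\sum_(1 <= n <oo) _)%E =
  (\sum_(0 <= n < N) cabs (a n.+1) ^+ 2 / d n.+1)%:E) //.
apply: cvg_lim => //; apply: cvg_near_cst.
exists N.+1 => // k /= Nk.
rewrite (@big_cat_nat _ _ _ N.+1) //= [X in (_ + X)%E](_ : _ = 0%E).
  by rewrite adde0 big_add1 /= sumEFin.
rewrite big_nat_cond big1 // => i /andP[/andP[Ni _] _].
by rewrite a0 // ComplexField.Normc.normc0 expr0n mul0r.
Qed.

Lemma finitely_supported_bound a : finitely_supported a ->
  exists N, forall n, (N < n)%N -> a n = 0.
Proof.
move=> /finite_seqP[s sE]; exists (\max_(i <- s) i) => n sn.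
apply/eqP; apply: contraTT sn => an; rewrite -leqNgt.
apply: leq_bigmax_seq => //.
by have : [set n | a n != 0] n by []; rewrite sE.
Qed.

Lemma cabs_sum (F : nat -> R[i]) N :
  cabs (\sum_(0 <= n < N) F n) <= \sum_(0 <= n < N) cabs (F n).
Proof.
apply: (big_ind2 (fun (x : R[i]) (y : R) => cabs x <= y)) => //.
  by rewrite ComplexField.Normc.normc0.
move=> x1 x2 y1 y2 h1 h2; apply: le_trans (lerD h1 h2).
exact: le_normcD.
Qed.

Lemma cabs_real (x : R) : cabs x%:C = `|x|.
Proof. by rewrite /= expr0n addr0 sqrtr_sqr. Qed.

End HankelFinite.

(** For A, B > 0 the optimal choice is l = sqrt B / sqrt A. If A or B vanishes there is no optimum;
    supposing T > 0, an explicit l makes the right side equal to T, so that 2 T <= T, a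
    contradiction. *)
Lemma le_sqrt_of_amgm (R : realType) (T K A B : R) :
  0 <= K -> 0 <= A -> 0 <= B ->
  (forall l, 0 < l -> 2 * T <= K * (l * A + l^-1 * B)) ->
  T <= K * Num.sqrt A * Num.sqrt B.
Proof.
move=> K0 A0 B0 H.
have [A1|A1] := eqVneq A 0.
  rewrite A1 sqrtr0 mulr0 mul0r leNgt; apply/negP => T0.
  have := H 1 ltr01; rewrite A1 invr1 !mul1r add0r => H1.
  have KB : 0 < K * B by lra.
  have := H (K * B / T) (divr_gt0 KB T0); rewrite A1 mulr0 add0r invf_div.
  have -> : K * (T / (K * B) * B) = T.
    move: (lt0r_neq0 KB); rewrite mulf_eq0 negb_or => /andP[h1 h2].
    by field; rewrite ?h1 ?h2.
  lra.
have [B1|B1] := eqVneq B 0.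
  rewrite B1 sqrtr0 mulr0 leNgt; apply/negP => T0.
  have := H 1 ltr01; rewrite B1 mulr0 mul1r addr0 => H1.
  have KA : 0 < K * A by lra.
  have := H (T / (K * A)) (divr_gt0 T0 KA); rewrite B1 mulr0 addr0.
  have -> : K * (T / (K * A) * A) = T.
    move: (lt0r_neq0 KA); rewrite mulf_eq0 negb_or => /andP[h1 h2].
    by field; rewrite ?h1 ?h2.
  lra.
have sA : 0 < Num.sqrt A by rewrite sqrtr_gt0 lt_def A1.
have sB : 0 < Num.sqrt B by rewrite sqrtr_gt0 lt_def B1.
have := H (Num.sqrt B / Num.sqrt A) (divr_gt0 sB sA).
rewrite -{2}(sqr_sqrtr A0) -{3}(sqr_sqrtr B0) invf_div.
have -> : Num.sqrt B / Num.sqrt A * Num.sqrt A ^+ 2 = Num.sqrt A * Num.sqrt B.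
  by field; rewrite lt0r_neq0.
have -> : Num.sqrt A / Num.sqrt B * Num.sqrt B ^+ 2 = Num.sqrt A * Num.sqrt B.
  by field; rewrite lt0r_neq0.
lra.
Qed.

(** * Boundedness of the Hankel form versus the growth condition *)

Section HankelGrowth.
Context {R : realType}.
Variables (nu : {finite_measure set R -> \bar R}) (alpha : R) (d : nat -> R).
Hypothesis alpha_gt0 : 0 < alpha.
Hypothesis hd : zeta_power_coeffs alpha d.
Local Notation D := (@half_line R).
Let mD := @measurable_half_line R.
Local Notation I e := (`]2^-1, 2^-1 + e]%classic : set R).

Lemma hankel_bounded_of_growth (C0 : R) : 0 <= C0 ->
  (forall r : R, 0 < r -> (nu (I r) <= (C0 * r `^ alpha)%:E)%E) ->
  hankel_bounded (fun n => (varrho d nu n)%:C) d.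
Proof.
move=> C00 gr.
have [K K0 HK] := moment_quadratic_form _ _ _ _ alpha_gt0 C00 gr hd.
exists K => a b /finitely_supported_bound[Na a0] /finitely_supported_bound[Nb
  b0].
pose N := maxn Na Nb.
have {}a0 n : (N < n)%N -> a n = 0 by rewrite gtn_max => /andP[/a0].
have {}b0 n : (N < n)%N -> b n = 0 by rewrite gtn_max => /andP[_ /b0].
rewrite (hankel_form_truncate _ _ hd.1 _ _ N) // !(l2norm_truncate _ _ N) //.
have dp n : 0 < d n.+1 by exact: hd.1.
(* The moments are nonnegative, so the complex form is dominated by the real one evaluated at the
   moduli. *)
apply: (@le_trans _ _ (\sum_(0 <= m < N) \sum_(0 <= n < N)
   cabs (a m.+1) * cabs (b n.+1) * moment nu (m.+1 * n.+1))).
  apply: le_trans (cabs_sum _ _) _; apply: ler_sum => m _.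
  apply: le_trans (cabs_sum _ _) _; apply: ler_sum => n _.
  rewrite !ComplexField.Normc.normcM cabs_real ger0_norm //.
  by apply: Rintegral_ge0 => s _; exact: powR_ge0.
apply: le_sqrt_of_amgm => //.
- by apply: sumr_ge0 => n _; rewrite divr_ge0 ?sqr_ge0 // ltW.
- by apply: sumr_ge0 => n _; rewrite divr_ge0 ?sqr_ge0 // ltW.
- by move=> l l0; exact: HK.
Qed.

Lemma measurable_near_interval (e : R) : measurable (I e).
Proof. exact: measurable_itv. Qed.

Lemma integrable_near_indic (e : R) : nu.-integrable D (EFin \o \1_(I e)).
Proof.
apply: (@integrableS _ _ _ nu setT) => //.
by apply: integrable_indic; exact: measurable_near_interval.
Qed.

Lemma Rintegral_near_indic (e : R) :
  \int[nu]_(s in D) \1_(I e) s = fine (nu (I e)).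
Proof.
rewrite /Rintegral integral_indic //; congr (fine (nu _)); apply/setIidPl => s.
by rewrite half_lineE /= in_itv /= => /andP[].
Qed.

(** Common end of the two test arguments: the pole of zeta gives zeta(1 + 2e)^alpha >=
    (4e)^(-alpha), which converts a bound on V zeta(1 + 2e)^alpha into growth of order e^alpha. *)
Lemma growth_of_zeta_powR (e V C : R) : 0 < e -> 0 <= V ->
  V * zeta_powR alpha (1 + 2 * e) <= C ->
  V <= C * 4 `^ alpha * e `^ alpha.
Proof.
move=> e0 V0 VC.
have e20 : 0 < 2 * e by rewrite mulr_gt0.
have := zeta_powR_ge _ alpha_gt0 _ e20; rewrite mulrA -natrM /= => zg.
have e40 : 0 < 4 * e by rewrite mulr_gt0.
rewrite -mulrA -powRM ?(ltW e0) // -ler_pdivrMr ?powR_gt0 // -powRN.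
by apply: le_trans VC; exact: ler_wpM2l.
Qed.

(** Keep only (1/2, 1/2 + e], where n^(-s) is at least its value at the right end. *)
Lemma moment_ge n (e : R) :
  n.+1%:R `^ (- (2^-1 + e)) * fine (nu (I e)) <= moment nu n.+1.
Proof.
rewrite -Rintegral_near_indic -RintegralZl //;
  last exact: integrable_near_indic.
apply: le_Rintegral => //.
- exact/integrable_rZl/integrable_near_indic.
- exact: integrable_natpow.
- move=> s _; rewrite indicE; case: (boolP (s \in _)) => [/set_mem|_];
    last by rewrite mulr0 powR_ge0.
  rewrite /= in_itv /= mulr1 => /andP[_ se].
  by apply: ler_powR; rewrite ?ler1n // lerN2.
Qed.

Lemma growth_of_hankel_bounded :
  hankel_bounded (fun n => (varrho d nu n)%:C) d ->
  exists2 C : R, 0 < C & forall e : R, 0 < e -> fine (nu (I e)) <=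
    C * e `^ alpha.
Proof.
move=> [C HC].
(* The constant in the definition of boundedness carries no sign; [C1] is a positive majorant. *)
pose C1 := `|C| + 1.
have C10 : 0 < C1 by rewrite ltr_wpDl.
exists (C1 * 4 `^ alpha) => [|e e0]; first by rewrite mulr_gt0 ?powR_gt0.
pose V := fine (nu (I e)).
have V0 : 0 <= V by exact: fine_ge0.
pose sg := 2^-1 + e.
apply: growth_of_zeta_powR => //; rewrite -/V.
have dp n : 0 < d n.+1 by exact: hd.1.
(* Test on a_n = d_n n^(-1/2-e) for n <= N. Its squared norm is S, the partial sum at 1 + 2e, and by
   [moment_ge] the form is at least V S^2; hence V S^2 <= C1 S. *)
have key N : V * dpsum d (1 + 2 * e) N <= C1.
  pose x n : R := d n * n%:R `^ (- sg).
  pose a n : R[i] := if ((0 < n) && (n <= N))%N then (x n)%:C else 0.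
  have a0 n : (N < n)%N -> a n = 0 by move=> Nn; rewrite /a (leqNgt n) Nn andbF.
  have fa : finitely_supported a.
    apply: (@sub_finite_set _ _ `I_N.+1) => [n /=|]; last exact: finite_II.
    by apply: contraR; rewrite -leqNgt => /a0 ->.
  have aE n : (n < N)%N -> a n.+1 = (x n.+1)%:C by move=> nN; rewrite /a nN.
  have x0 n : 0 <= x n.+1 by rewrite mulr_ge0 ?powR_ge0 // ltW.
  have := HC a a fa fa.
  rewrite (hankel_form_truncate _ _ hd.1 _ _ N) // !(l2norm_truncate _ _ N) //.
  set S := dpsum d (1 + 2 * e) N.
  have S0 : 0 <= S by apply: sumr_ge0 => n _; rewrite mulr_ge0 ?powR_ge0 // ltW.
  have x2 n : n.+1%:R `^ (- sg) * n.+1%:R `^ (- sg) =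
    n.+1%:R `^ (- (1 + 2 * e)) :> R.
    by rewrite -natpowD; congr (_ `^ (- _)); rewrite /sg; lra.
  have -> : \sum_(0 <= n < N) cabs (a n.+1) ^+ 2 / d n.+1 = S.
    apply: eq_big_nat => n /andP[_ nN]; rewrite aE // cabs_real ger0_norm //.
    by rewrite /x -x2; field; rewrite lt0r_neq0.
  rewrite -mulrA -expr2 sqr_sqrtr //.
  have -> : \sum_(0 <= m < N) \sum_(0 <= n < N)
      a m.+1 * a n.+1 * (moment nu (m.+1 * n.+1))%:C =
    (\sum_(0 <= m < N) \sum_(0 <= n < N)
      x m.+1 * x n.+1 * moment nu (m.+1 * n.+1))%:C.
    rewrite rmorph_sum /=; apply: eq_big_nat => m /andP[_ mN].
    rewrite rmorph_sum /=; apply: eq_big_nat => n /andP[_ nN].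
    by rewrite !aE // -!rmorphM.
  rewrite cabs_real.
  have : V * S * S <= \sum_(0 <= m < N) \sum_(0 <= n < N)
      x m.+1 * x n.+1 * moment nu (m.+1 * n.+1).
    rewrite -mulrA /S /dpsum big_distrlr /= mulr_sumr; apply: ler_sum => m _.
    rewrite mulr_sumr; apply: ler_sum => n _.
    (* The predecessor compensates for the successor built into [moment_ge]. *)
    have := moment_ge (m.+1 * n.+1).-1 e.
    rewrite prednK ?muln_gt0 // -/V natpowM -/sg => H.
    apply: le_trans (ler_wpM2l (mulr_ge0 (x0 m) (x0 n)) H).
    rewrite -!x2 /x le_eqVlt; apply/orP; left; apply/eqP; ring.
  move=> H1 H2.
  have H3 : V * S * S <= C1 * S.
    apply: le_trans H1 _; apply: le_trans (ler_norm _) _; apply: le_trans H2 _.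
    by apply: ler_wpM2r => //; rewrite /C1; have := ler_norm C; lra.
  have [S1|S1] := eqVneq S 0; first by rewrite S1 mulr0 ltW.
  by rewrite -(@ler_pM2r _ S) // lt_def S1.
have [V1|V1] := eqVneq V 0; first by rewrite V1 mul0r ltW.
have {}V0 : 0 < V by rewrite lt_def V1.
rewrite mulrC -ler_pdivlMr //.
have e1 : 1 < 1 + 2 * e by rewrite ltrDl mulr_gt0.
have c := zeta_powR_cvg _ _ hd _ e1.
rewrite -(cvg_lim (@Rhausdorff R) c); apply: limr_le.
  by apply/cvg_ex; eexists; exact: c.
by apply: nearW => N; rewrite ler_pdivlMr // mulrC.
Qed.

End HankelGrowth.

(** * The integral operator with kernel zeta(s + t)^alpha on real functions *)

Section ZetaKernel.
Context {R : realType}.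
Variables (nu : {finite_measure set R -> \bar R}) (alpha : R) (d : nat -> R).
Hypothesis alpha_gt0 : 0 < alpha.
Hypothesis hd : zeta_power_coeffs alpha d.
Local Notation D := (@half_line R).
Let mD := @measurable_half_line R.
Let d_gt0 n : 0 < d n.+1. Proof. exact: hd.1. Qed.
Implicit Type u : R -> R.

Lemma measurable_dpsum_shift (t : R) N : measurable_fun D (fun s =>
  dpsum d (s + t) N).
Proof.
apply: measurable_sum => n; apply: measurable_funM => //.
under eq_fun do rewrite natpowD.
by apply: measurable_funM => //; exact: measurable_natpow.
Qed.

Lemma half_line_add (s t : R) : D s -> D t -> 1 < s + t.
Proof. rewrite !half_lineE; lra. Qed.

Lemma zeta_powR_ge0 (x : R) : 0 <= zeta_powR alpha x.
Proof. exact: powR_ge0. Qed.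

(** A pointwise limit of Dirichlet polynomials, which are measurable. *)
Lemma measurable_zeta_powR_shift (t : R) : D t ->
  measurable_fun D (fun s => zeta_powR alpha (s + t)).
Proof.
move=> Dt; apply: (measurable_fun_cvg (measurable_dpsum_shift t)).
by move=> s Ds; apply: zeta_powR_cvg => //; exact: half_line_add.
Qed.

(** Since |u| <= 1 + u^2 and the measure is finite, square integrability implies integrability. *)
Lemma integrable_of_sqr u : measurable_fun D u ->
  (\int[nu]_(s in D) (u s ^+ 2)%:E < +oo)%E ->
  nu.-integrable D (EFin \o (fun s =>
    u s ^+ 2)) /\ nu.-integrable D (EFin \o u).
Proof.
move=> mu u2.
have i2 : nu.-integrable D (EFin \o (fun s => u s ^+ 2)).
  apply/integrableP; split; first exact/measurable_EFinP/measurable_funX.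
  by under eq_integral do rewrite /= ger0_norm ?sqr_ge0 //.
split => //.
apply: (@le_integrable _ _ _ nu D mD _ ((EFin \o cst 1%R) \+ (EFin \o (fun s =>
  u s ^+ 2)%R))%E).
- exact/measurable_EFinP.
- move=> s _ /=; rewrite lee_fin [leRHS]ger0_norm ?addr_ge0 ?sqr_ge0 //.
  rewrite -[u s ^+ 2]real_normK ?num_real //.
  by move: (`|u s|) (normr_ge0 (u s)) => v v0; have := sqr_ge0 (v - 1); nra.
- by apply: integrableD => //; exact: finite_measure_integrable_cst.
Qed.

Definition zeta_transform u (t : R) : R :=
  \int[nu]_(s in D) (zeta_powR alpha (s + t) * u s).

(** A majorant uniform in s: zeta^alpha decreases and 1/2 + t > 1, so its value at 1/2 + t bounds
    the kernel. It serves both for z the kernel itself and for z one of its partial sums. *)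
Lemma dpsum_kernel_bound (t s : R) (z : R) u : D t -> D s ->
  0 <= z <= zeta_powR alpha (s + t) ->
  `|z * u s| <= `|zeta_powR alpha (2^-1 + t) * u s|.
Proof.
move=> Dt Ds /andP[z0 zl]; rewrite !normrM; apply: ler_wpM2r => //.
have zz : zeta_powR alpha (s + t) <= zeta_powR alpha (2^-1 + t).
  by move: Ds Dt; rewrite !half_lineE => Ds Dt;
    apply: zeta_powR_le_mono hd _ _ _ _; lra.
rewrite (ger0_norm z0) (ger0_norm (zeta_powR_ge0 _)).
exact: le_trans zl zz.
Qed.

Lemma integrable_zeta_kernel u (t : R) : D t -> nu.-integrable D (EFin \o u) ->
  nu.-integrable D (EFin \o (fun s => zeta_powR alpha (s + t) * u s)).
Proof.
move=> Dt ui.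
apply: (@le_integrable _ _ _ nu D mD _ (EFin \o (fun s =>
  zeta_powR alpha (2^-1 + t) * u s))).
- apply/measurable_EFinP/measurable_funM;
    first exact: measurable_zeta_powR_shift.
  exact/measurable_EFinP/measurable_int/ui.
- move=> s Ds; rewrite /= lee_fin; apply: dpsum_kernel_bound => //.
  by rewrite zeta_powR_ge0 lexx.
- exact: integrable_rZl.
Qed.

Definition dirichlet_moment u n : R :=
  \int[nu]_(s in D) (n.+1%:R `^ (- s) * u s).

Definition zeta_transform_psum u N (t : R) : R :=
  \sum_(0 <= n < N) (d n.+1 * dirichlet_moment u n) * n.+1%:R `^ (- t).

(** The truncation is the integral of u against the partial sum of the kernel; dominated convergence
    applies with the majorant of [dpsum_kernel_bound]. *)
Lemma zeta_transform_cvg u (t : R) : D t -> nu.-integrable D (EFin \o u) ->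
  (fun N => zeta_transform_psum u N t) @ \oo --> zeta_transform u t.
Proof.
move=> Dt ui.
have mu : measurable_fun D u by exact/measurable_EFinP/measurable_int/ui.
have E N : zeta_transform_psum u N t =
  \int[nu]_(s in D) (dpsum d (s + t) N * u s).
  have -> : \int[nu]_(s in D) (dpsum d (s + t) N * u s) =
    \int[nu]_(s in D) (\sum_(0 <= n < N)
       (d n.+1 * n.+1%:R `^ (- t)) * (n.+1%:R `^ (- s) * u s)).
    apply: eq_Rintegral => s _; rewrite /dpsum mulr_suml; apply: eq_bigr => n _.
    by rewrite natpowD; ring.
  rewrite Rintegral_sum; last by move=> n;
    exact/integrable_rZl/integrable_natpowM.
  apply: eq_bigr => n _; rewrite RintegralZl //; last exact/integrable_natpowM.
  by rewrite mulrAC.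
under eq_fun do rewrite E.
have zi := integrable_zeta_kernel _ _ Dt ui.
apply: (@fine_cvg R nat \oo _ (fun N =>
  \int[nu]_(s in D) (dpsum d (s + t) N * u s)%:E)%E).
rewrite /zeta_transform /Rintegral fineK;
  last exact: (integrable_fin_num mD zi).
have [] := @dominated_convergence _ _ _ nu D mD
  (fun N s => (dpsum d (s + t) N * u s)%:E)
  (fun s => (zeta_powR alpha (s + t) * u s)%:E)
  (fun s => `|(zeta_powR alpha (2^-1 + t) * u s)%:E|%E).
- move=> N; apply/measurable_EFinP/measurable_funM => //.
  exact: measurable_dpsum_shift.
- by apply/measurable_EFinP/measurable_funM => //;
    exact: measurable_zeta_powR_shift.
- apply: aeW => s Ds; apply: cvg_EFin; first by apply: nearW.
  apply: cvgMr_tmp.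
  by apply: zeta_powR_cvg => //; exact: half_line_add.
- exact/integrable_abse/integrable_rZl.
- apply: aeW => s N Ds; rewrite lee_fin; apply: dpsum_kernel_bound => //.
  apply/andP; split; first by apply: sumr_ge0 => n _;
    rewrite mulr_ge0 ?powR_ge0 // ltW.
  by apply: dpsum_le_zeta_powR => //; exact: half_line_add.
- by move=> _ _.
Qed.

Lemma measurable_zeta_transform_psum u N : measurable_fun D
  (zeta_transform_psum u N).
Proof.
apply: measurable_sum => n; apply: measurable_funM => //.
exact: measurable_natpow.
Qed.

Lemma measurable_zeta_transform u : nu.-integrable D (EFin \o u) ->
  measurable_fun D (zeta_transform u).
Proof.
move=> ui; apply: (measurable_fun_cvg (measurable_zeta_transform_psum u)).
by move=> t Dt; exact: zeta_transform_cvg.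
Qed.

Lemma limn_einf_le (v : nat -> \bar R) (c : \bar R) :
  (forall n, (v n <= c)%E) -> (limn_einf v <= c)%E.
Proof.
move=> vc; rewrite limn_einf_lim; apply: lime_le; first exact: is_cvg_einfs.
apply: nearW => n; apply: le_trans (vc n).
by apply: ereal_inf_lbound; exists n => //=.
Qed.

Section Bounded.
Variable C0 : R.
Hypothesis C0_ge0 : 0 <= C0.
Hypothesis nu_growth : forall r : R, 0 < r ->
  (nu (`]2^-1, 2^-1 + r]%classic)%R <= (C0 * r `^ alpha)%:E)%E.

Lemma zeta_transform_bounded : exists2 K : R, 0 <= K & forall u,
  measurable_fun D u -> (\int[nu]_(s in D) (u s ^+ 2)%:E < +oo)%E ->
  (\int[nu]_(t in D) (zeta_transform u t ^+ 2)%:E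
   <= K%:E * \int[nu]_(s in D) (u s ^+ 2)%:E)%E.
Proof.
have [K K0 HK] := moment_quadratic_form _ _ _ _ alpha_gt0 C0_ge0 nu_growth hd.
pose K1 := K + 1.
have K10 : 0 < K1 by rewrite ltr_wpDl.
exists (K * K1) => [|u mu u2]; first by rewrite mulr_ge0 // ltW.
have [i2 i1] := integrable_of_sqr _ mu u2.
pose U := \int[nu]_(s in D) (u s ^+ 2).
have UE : (\int[nu]_(s in D) (u s ^+ 2)%:E)%E = U%:E.
  by rewrite /U /Rintegral fineK //; exact: (integrable_fin_num mD i2).
pose c := dirichlet_moment u.
pose x n := d n.+1 * c n.
pose E n (t : R) : R := n.+1%:R `^ (- t).
have iEE m n : nu.-integrable D (EFin \o (fun t =>
  x m * x n * (E m t * E n t))).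
  exact/integrable_rZl/integrable_natpowM/integrable_natpow.
have sqE N t : zeta_transform_psum u N t ^+ 2 =
    \sum_(0 <= m < N) \sum_(0 <= n < N) x m * x n * (E m t * E n t).
  rewrite expr2 /zeta_transform_psum big_distrlr /=.
  by apply: eq_bigr => m _; apply: eq_bigr => n _; rewrite mulrACA.
have isq N : nu.-integrable D (EFin \o (fun t =>
  zeta_transform_psum u N t ^+ 2)).
  rewrite (_ : (fun t => _) = (fun t => \sum_(0 <= m < N) \sum_(0 <=
    n < N) x m * x n * (E m t * E n t))); last exact/funext.
  by apply: integrable_rsum => m; apply: integrable_rsum => n.
pose Q N := \int[nu]_(t in D) (zeta_transform_psum u N t ^+ 2).
pose S N := \sum_(0 <= n < N) d n.+1 * c n ^+ 2.
(* Expanding the square gives the Hankel form at x_n = d_n c_n, taken twice, and x_n^2/d_n = d_n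
   c_n^2; [moment_quadratic_form] is used at l = 1. *)
have QS N : Q N <= K * S N.
  have -> : Q N = \sum_(0 <= m < N) \sum_(0 <=
    n < N) x m * x n * moment nu (m.+1 * n.+1).
    rewrite /Q; under eq_Rintegral do rewrite sqE.
    rewrite Rintegral_sum; last by move=> m; exact: integrable_rsum.
    apply: eq_bigr => m _; rewrite Rintegral_sum //; apply: eq_bigr => n _.
    rewrite RintegralZl //; last exact/integrable_natpowM/integrable_natpow.
    by congr (_ * _); apply: eq_Rintegral => t _; rewrite natpowM.
  have := HK N x x 1 ltr01.
  have -> : \sum_(0 <= m < N) x m ^+ 2 / d m.+1 = S N.
    by apply: eq_bigr => n _; rewrite /x; field; rewrite lt0r_neq0.
  rewrite invr1 !mul1r; lra.
(* [S N] is the inner product of u with its truncated transform, hence at most (K1/2) U + Q/(2 K1).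
   Since Q <= K S <= K1 S, the last term is at most S/2 and is absorbed on the left. *)
have SU N : S N <= K1 * U.
  have iu : nu.-integrable D (EFin \o (fun t =>
    zeta_transform_psum u N t * u t)).
    rewrite (_ : (fun t => _) = (fun t => \sum_(0 <=
      n < N) x n * (E n t * u t))).
      by apply: integrable_rsum => n; exact/integrable_rZl/integrable_natpowM.
    apply/funext => t; rewrite /zeta_transform_psum mulr_suml;
      apply: eq_bigr => n _.
    by rewrite mulrA.
  have SE : S N = \int[nu]_(t in D) (zeta_transform_psum u N t * u t).
    rewrite /zeta_transform_psum; under eq_Rintegral do rewrite mulr_suml.
    under eq_Rintegral do under eq_bigr do rewrite -mulrA.
    rewrite Rintegral_sum; last by move=> n;
      exact/integrable_rZl/integrable_natpowM.
    apply: eq_bigr => n _; rewrite RintegralZl //;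
      last exact/integrable_natpowM.
    by rewrite -/(dirichlet_moment u n) -/(c n); ring.
  have : S N <= K1 / 2 * U + (2 * K1)^-1 * Q N.
    rewrite SE -RintegralZl // -RintegralZl // -RintegralD //; first last.
    - exact: integrable_rZl.
    - exact: integrable_rZl.
    apply: le_Rintegral => //.
      apply: (@eq_integrable _ _ _ nu D mD
        ((EFin \o (fun s => K1 / 2 * u s ^+ 2)%R) \+
         (EFin \o (fun s => (2 * K1)^-1 * zeta_transform_psum u N s ^+
           2)%R))%E).
        by move=> s _ /=; rewrite EFinD.
      by apply: integrableD => //; exact: integrable_rZl.
    move=> t _; set z := zeta_transform_psum u N t.
    rewrite -subr_ge0 (_ : _ - _ = (K1 * u t - z) ^+ 2 / (2 * K1)).
      by rewrite divr_ge0 ?sqr_ge0 // mulr_ge0 // ltW.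
    by field; rewrite lt0r_neq0.
  have : (2 * K1)^-1 * Q N <= S N / 2.
    rewrite ler_pdivrMl ?mulr_gt0 //; apply: le_trans (QS N) _.
    have S0 : 0 <= S N by apply: sumr_ge0 => n _;
      rewrite mulr_ge0 ?sqr_ge0 // ltW.
    rewrite /K1; lra.
  lra.
have QU N : Q N <= K * K1 * U.
  by apply: le_trans (QS N) _; rewrite -mulrA; exact: ler_wpM2l.
rewrite UE -EFinM.
(* The bound on [Q N] is uniform in N; writing the squared transform as a lower limit lets Fatou's
   lemma carry it over. *)
have -> : (\int[nu]_(t in D) (zeta_transform u t ^+ 2)%:E =
  \int[nu]_(t in D) limn_einf (fun N => (zeta_transform_psum u N t ^+ 2)%:E))%E.
  apply: eq_integral => t /set_mem Dt; apply/esym.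
  apply: (cvg_limn_einf_sup _).1.
  apply: cvg_EFin; first exact: nearW.
  have h := zeta_transform_cvg u t Dt i1.
  by rewrite expr2; under eq_fun do rewrite expr2; exact: cvgM.
apply: le_trans (fatou nu mD _ _) _ => //.
- move=> N; apply/measurable_EFinP/measurable_funX.
  exact: measurable_zeta_transform_psum.
- by move=> N t _; rewrite lee_fin sqr_ge0.
apply: limn_einf_le => N.
have -> : (\int[nu]_(t in D) (zeta_transform_psum u N t ^+ 2)%:E)%E = (Q N)%:E.
  by rewrite /Q /Rintegral fineK //; exact: (integrable_fin_num mD (isq N)).
by rewrite lee_fin.
Qed.

End Bounded.

End ZetaKernel.

(** * Boundedness of the operator on complex L^2 versus the growth condition *)

Section L2Operator.
Context {R : realType}.
Variables (nu : {finite_measure set R -> \bar R}) (alpha : R) (d : nat -> R).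
Hypothesis alpha_gt0 : 0 < alpha.
Hypothesis hd : zeta_power_coeffs alpha d.
Local Notation D := (@half_line R).
Let mD := @measurable_half_line R.
Local Notation I e := (`]2^-1, 2^-1 + e]%classic : set R).
Implicit Type f : R -> R[i].

Lemma cabs_sqr (z : R[i]) : cabs z ^+ 2 = complex.Re z ^+ 2 + complex.Im z ^+ 2.
Proof. by case: z => x y /=; rewrite sqr_sqrtr // addr_ge0 ?sqr_ge0. Qed.

Lemma Re_realM (x : R) (z : R[i]) : complex.Re (x%:C * z) = x * complex.Re z.
Proof. by case: z => y w /=; rewrite mul0r subr0. Qed.

Lemma Im_realM (x : R) (z : R[i]) : complex.Im (x%:C * z) = x * complex.Im z.
Proof. by case: z => y w /=; rewrite mul0r addr0. Qed.

Lemma Re_Kop f t :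
  complex.Re (Kop alpha nu f t) = zeta_transform nu alpha (fun s =>
    complex.Re (f s)) t.
Proof. by apply: eq_Rintegral => s _; rewrite Re_realM. Qed.

Lemma Im_Kop f t :
  complex.Im (Kop alpha nu f t) = zeta_transform nu alpha (fun s =>
    complex.Im (f s)) t.
Proof. by apply: eq_Rintegral => s _; rewrite Im_realM. Qed.

Lemma L2sqnormE f :
  measurable_fun D (fun s => complex.Re (f s)) ->
  measurable_fun D (fun s => complex.Im (f s)) ->
  L2sqnorm nu f = (\int[nu]_(s in D) (complex.Re (f s) ^+ 2)%:E
                   + \int[nu]_(s in D) (complex.Im (f s) ^+ 2)%:E)%E.
Proof.
move=> mr mi; rewrite /L2sqnorm.
under eq_integral do rewrite cabs_sqr EFinD.
rewrite ge0_integralD //.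
- by move=> s _; rewrite lee_fin sqr_ge0.
- exact/measurable_EFinP/measurable_funX.
- by move=> s _; rewrite lee_fin sqr_ge0.
- exact/measurable_EFinP/measurable_funX.
Qed.

Lemma L2_bounded_of_growth (C0 : R) : 0 <= C0 ->
  (forall r : R, 0 < r -> (nu (I r) <= (C0 * r `^ alpha)%:E)%E) ->
  L2_bounded nu (Kop alpha nu).
Proof.
move=> C00 gr.
have [K K0 HK] := zeta_transform_bounded _ _ _ alpha_gt0 hd _ C00 gr.
(* The kernel is real, so real and imaginary parts are transformed separately and their squared
   norms add up with the same constant K. *)
exists (Num.sqrt K) => f [mr mi fin].
have := fin; rewrite L2sqnormE //.
set A := (\int[nu]_(s in D) (complex.Re (f s) ^+ 2)%:E)%E.
set B := (\int[nu]_(s in D) (complex.Im (f s) ^+ 2)%:E)%E.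
have A0 : (0 <= A)%E by apply: integral_ge0 => s _; rewrite lee_fin sqr_ge0.
have B0 : (0 <= B)%E by apply: integral_ge0 => s _; rewrite lee_fin sqr_ge0.
move=> AB.
have Ay : (A < +oo)%E by apply: le_lt_trans AB; rewrite leeDl.
have By : (B < +oo)%E by apply: le_lt_trans AB; rewrite leeDr.
have [_ ir] := integrable_of_sqr nu _ mr Ay.
have [_ ii] := integrable_of_sqr nu _ mi By.
have mKr : measurable_fun D (fun t => complex.Re (Kop alpha nu f t)).
  by under eq_fun do rewrite Re_Kop;
    exact: (measurable_zeta_transform _ _ _ hd).
have mKi : measurable_fun D (fun t => complex.Im (Kop alpha nu f t)).
  by under eq_fun do rewrite Im_Kop;
    exact: (measurable_zeta_transform _ _ _ hd).
have KE : (L2sqnorm nu (Kop alpha nu f) <= K%:E * L2sqnorm nu f)%E.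
  rewrite !L2sqnormE // ge0_muleDr //; apply: leeD.
    by under eq_integral do rewrite Re_Kop; exact: HK.
  by under eq_integral do rewrite Im_Kop; exact: HK.
have f0 : (0 <= L2sqnorm nu f)%E by apply: integral_ge0 => s _;
  rewrite lee_fin sqr_ge0.
have Kf0 : (0 <= L2sqnorm nu (Kop alpha nu f))%E.
  by apply: integral_ge0 => s _; rewrite lee_fin sqr_ge0.
have fE : L2sqnorm nu f = (fine (L2sqnorm nu f))%:E by rewrite fineK //
  ge0_fin_numE.
have Kfin : (L2sqnorm nu (Kop alpha nu f) < +oo)%E.
  by apply: le_lt_trans KE _; rewrite fE -EFinM ltry.
split; first by split.
rewrite /L2norm -sqrtrM //; apply: ler_wsqrtr.
by rewrite -lee_fin EFinM -fE fineK // ge0_fin_numE.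
Qed.

Lemma growth_of_L2_bounded : L2_bounded nu (Kop alpha nu) ->
  exists2 C : R, 0 < C & forall e : R, 0 < e -> fine (nu (I e)) <=
    C * e `^ alpha.
Proof.
move=> [C HC].
pose C1 := `|C| + 1.
have C10 : 0 < C1 by rewrite ltr_wpDl.
exists (C1 * 4 `^ alpha) => [|e e0]; first by rewrite mulr_gt0 ?powR_gt0.
pose V := fine (nu (I e)).
have V0 : 0 <= V by exact: fine_ge0.
apply: growth_of_zeta_powR => //; rewrite -/V.
have [V1|V1] := eqVneq V 0; first by rewrite V1 mul0r ltW.
have Vgt0 : 0 < V by rewrite lt_def V1.
pose f (s : R) : R[i] := (\1_(I e) s)%:C.
have ID : I e `<=` D by move=> s; rewrite half_lineE /= in_itv /= => /andP[].
have mI : measurable (I e) by exact: measurable_itv.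
have VE : (\int[nu]_(s in D) (\1_(I e) s)%:E = V%:E)%E.
  rewrite integral_indic // /V fineK ?fin_num_measure //; congr (nu _).
  exact/setIidPl.
have fE : L2sqnorm nu f = V%:E.
  rewrite -VE; apply: eq_integral => s _; rewrite cabs_real indicE.
  by case: (_ \in _); rewrite ?normr1 ?normr0 ?expr1n ?expr0n.
have mf : measurable_fun D (\1_(I e) : R -> R) by exact: measurable_indic.
have fL2 : inL2 nu f by split => //; rewrite fE ltry.
have [[mKr mKi Kfin] Kle] := HC f fL2.
have [z zE] : exists z, z = zeta_powR alpha (1 + 2 * e) by eexists.
rewrite -zE; have z0 : 0 <= z by rewrite zE powR_ge0.
have ii := integrable_near_indic nu e.
have VM (y : R) : V * y = \int[nu]_(s in D) (y * \1_(I e) s).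
  by rewrite RintegralZl // Rintegral_near_indic mulrC.
(* For s and t both in (1/2, 1/2 + e], s + t <= 1 + 2e, so the kernel is at least z there. *)
have Kge t : I e t -> V * z <= complex.Re (Kop alpha nu f t).
  move=> It.
  have k1 := integrable_rZl nu z _ ii.
  have k2 := integrable_zeta_kernel nu _ _ hd _ _ (ID _ It) ii.
  rewrite Re_Kop VM; apply: (le_Rintegral mD k1 k2).
  move=> s _; change (z * \1_(I e) s <= zeta_powR alpha (s + t) * \1_(I e) s).
  have [/set_mem Is|nIs] := boolP (s \in I e); last first.
    have -> : \1_(I e) s = 0 :> R by rewrite indicE (negbTE nIs).
    by rewrite 2!mulr0.
  apply: ler_wpM2r; first by rewrite indicE ler0n.
  rewrite zE; apply: (zeta_powR_le_mono _ _ hd); move: It Is;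
    rewrite /= !in_itv /=; lra.
have Vz0 : 0 <= V * z by rewrite mulr_ge0.
(* Integrating the lower bound over the same interval, of mass V; since f has squared norm V,
   boundedness will leave V z <= C. *)
have low : (((V * z) ^+ 2 * V)%:E <= L2sqnorm nu (Kop alpha nu f))%E.
  rewrite EFinM -VE -ge0_integralZl_EFin ?sqr_ge0 //;
    last exact/measurable_EFinP.
  apply: ge0_le_integral => //.
  - by move=> s _; rewrite -EFinM lee_fin mulr_ge0 ?sqr_ge0.
  - by apply/measurable_EFinP/measurable_funM.
  - apply/measurable_EFinP; under eq_fun do rewrite cabs_sqr.
    by apply: measurable_funD; exact: measurable_funX.
  move=> t _; rewrite -EFinM lee_fin indicE.
  case: (boolP (t \in _)) => [/set_mem It|_]; last by rewrite mulr0 sqr_ge0.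
  rewrite mulr1 cabs_sqr; apply: ler_wpDr; first exact: sqr_ge0.
  by rewrite ler_sqr ?nnegrE ?Kge // (le_trans Vz0) // Kge.
have Kf0 : (0 <= L2sqnorm nu (Kop alpha nu f))%E.
  by apply: integral_ge0 => s _; rewrite lee_fin sqr_ge0.
move: Kle; rewrite {2}/L2norm fE /= => Kle.
have : Num.sqrt ((V * z) ^+ 2 * V) <= C * Num.sqrt V.
  apply: le_trans Kle; apply: ler_wsqrtr.
  by rewrite -lee_fin fineK // ge0_fin_numE.
rewrite sqrtrM ?sqr_ge0 // sqrtr_sqr ger0_norm // ler_pM2r ?sqrtr_gt0 // => H.
by apply: (le_trans H); rewrite /C1; have := ler_norm C; lra.
Qed.

End L2Operator.

(** * Decay of the coefficients versus the growth condition, and passage from small to all radii *)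

Section Coefficients.
Context {R : realType}.
Variables (nu : {finite_measure set R -> \bar R}) (alpha : R).
Hypothesis alpha_gt0 : 0 < alpha.
Local Notation D := (@half_line R).
Let mD := @measurable_half_line R.
Local Notation I e := (`]2^-1, 2^-1 + e]%classic : set R).

Lemma moment_decay_of_growth (C0 : R) : 0 <= C0 ->
  (forall r : R, 0 < r -> (nu (I r) <= (C0 * r `^ alpha)%:E)%E) ->
  exists2 C : R, 0 < C & forall n, (2 <= n)%N ->
    moment nu n <= C * (Num.sqrt n%:R * (ln n%:R) `^ alpha)^-1.
Proof.
move=> C00 gr.
pose K := C0 * ((2 * alpha) `^ alpha * expR 2^-1) / (1 - expR (- 2^-1)).
have q1 : expR (- 2^-1) < 1 :> R by rewrite -expR0 ltr_expR oppr_lt0 invr_gt0.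
have K0 : 0 <= K.
  by rewrite /K divr_ge0 ?subr_ge0 ?(ltW q1) // !mulr_ge0 ?powR_ge0 ?expR_ge0.
exists (K + 1) => [|n n2]; first by rewrite ltr_wpDl.
have n0 : 0 < n%:R :> R by rewrite ltr0n; lia.
have L0 : 0 < ln n%:R :> R by rewrite ln_gt0 // ltr1n.
(* Splitting off n^(-1/2) leaves the exponential of [integral_expR_le] with L = ln n. *)
have E (s : R) : n%:R `^ (- s) = (Num.sqrt n%:R)^-1 * expR (- ((s - 2^-1) * ln
  n%:R)).
  rewrite -powR12_sqrt ?ltW // -powRN.
  rewrite /powR (gt_eqF n0) -expRD; congr expR; ring.
have H := integral_expR_le _ _ _ alpha_gt0 C00 gr _ L0.
have mE : measurable_fun D (fun s : R => expR (- ((s - 2^-1) * ln n%:R))).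
  apply: measurableT_comp; first exact: measurable_expR.
  apply: measurableT_comp => //; apply: measurable_funM => //.
  exact: measurable_funB.
have H2 : \int[nu]_(s in D) expR (- ((s - 2^-1) * ln n%:R)) <=
  (K + 1) * (ln n%:R) `^ (- alpha).
  apply: (@Rintegral_le_bound _ nu _ _ _ mE mE).
    by move=> s _; rewrite expR_ge0 lexx.
  apply: le_trans H _; rewrite lee_fin.
  apply: (@le_trans _ _ (K * (ln n%:R) `^ (- alpha))); last first.
    by rewrite ler_wpM2r ?powR_ge0 // lerDl.
  by rewrite /K le_eqVlt; apply/orP; left; apply/eqP; rewrite !mulrA; ring.
rewrite /moment; under eq_Rintegral do rewrite E.
rewrite RintegralZl //; last first.
  apply/integrableP; split; first exact/measurable_EFinP.
  under eq_integral do rewrite /= ger0_norm ?expR_ge0 //.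
  by apply: le_lt_trans H _; rewrite ltry.
rewrite invfM mulrCA; apply: ler_wpM2l; first by rewrite invr_ge0 sqrtr_ge0.
by rewrite -powRN.
Qed.

Lemma growth_of_moment_decay (C : R) : 0 < C ->
  (forall n, (2 <= n)%N ->
    moment nu n <= C * (Num.sqrt n%:R * (ln n%:R) `^ alpha)^-1) ->
  forall e : R, 0 < e -> e < 1 ->
    fine (nu (I e)) <= C * expR 1 * 2 `^ alpha * e `^ alpha.
Proof.
move=> C0 H e e0 e1.
(* With n just below exp(1/e), n^e is at most the constant exp 1, while ln n is still of order 1/e.
   The assumption e < 1 ensures n >= 2. *)
pose n := Num.truncn (expR e^-1 : R).
have ei : 1 < e^-1 by rewrite invf_gt1.
have n2 : (2 <= n)%N.
  rewrite /n truncn_ge_nat ?expR_ge0 //.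
  by apply: le_trans (expR_ge1Dx _); lra.
have n0 : 0 < n%:R :> R by rewrite ltr0n; lia.
have L0 : 0 < ln n%:R :> R by rewrite ln_gt0 // ltr1n.
have nle : n%:R <= expR e^-1 :> R by rewrite truncn_le expR_ge0.
have nlt : expR e^-1 < n.+1%:R :> R by exact: truncnS_gt.
(* For n >= 2, exp(1/e) < n + 1 <= n^2; taking logarithms costs the factor 2. *)
have Lge : (2 * e)^-1 <= ln n%:R :> R.
  have : expR e^-1 <= n%:R ^+ 2 :> R.
    by apply: le_trans (ltW nlt) _; rewrite -natrX ler_nat; nia.
  rewrite -ler_ln ?posrE ?expR_gt0 ?exprn_gt0 // expRK lnXn // mulr2n invfM;
    lra.
have V0 : 0 <= fine (nu (I e)) by exact: fine_ge0.
have := le_trans (moment_ge nu n.-1 e) _; rewrite prednK; last lia.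
move=> /(_ _ (H n n2)).
rewrite opprD powRDpos // [n%:R `^ (- 2^-1)]powRN powR12_sqrt ?(ltW n0) //.
rewrite invfM [leRHS]mulrCA -mulrA ler_pM2l ?invr_gt0 ?sqrtr_gt0 //.
rewrite powRN ler_pdivrMl ?powR_gt0 // => /le_trans; apply.
have ne : n%:R `^ e <= expR 1 :> R.
  have -> : expR 1 = (expR e^-1) `^ e :> R.
    by rewrite /powR (gt_eqF (expR_gt0 _)) expRK mulfV ?lt0r_neq0.
  by apply: ge0_ler_powR; rewrite ?nnegrE ?expR_ge0 ?(ltW e0) ?(ltW n0).
have e20 : 0 < 2 * e by rewrite mulr_gt0.
have La : ((ln n%:R) `^ alpha)^-1 <= (2 * e) `^ alpha :> R.
  rewrite -powRN; apply: le_trans (powR_inv_le _ _ _ (ltW alpha_gt0) _ Lge) _.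
    by rewrite invr_gt0.
  by rewrite -powR_inv1 ?(ltW e20) // -powRrM mulN1r opprK.
rewrite mulrCA -[leRHS]mulrA -powRM ?(ltW e0) // -mulrA.
apply: ler_wpM2l; first exact: ltW.
by apply: ler_pM => //; rewrite ?powR_ge0 // invr_ge0 powR_ge0.
Qed.

(** Beyond a fixed radius e2 the total mass V suffices: V <= V (r/e2)^alpha for r >= e2. So the
    condition near 0 becomes one for all radii, as the integral estimates require. *)
Lemma growth_global (C : R) : 0 < C ->
  (\forall e \near 0^'+, (nu (I e) <= (C * e `^ alpha)%:E)%E) ->
  exists2 C0 : R, 0 <= C0 & forall r : R, 0 < r -> (nu (I r) <=
    (C0 * r `^ alpha)%:E)%E.
Proof.
move=> C0 [e /= e0 He].
pose V := fine (nu setT).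
have V0 : 0 <= V by exact: fine_ge0.
pose e2 := e / 2.
have e20 : 0 < e2 by rewrite divr_gt0.
exists (C + V / e2 `^ alpha) => [|r r0].
  by rewrite addr_ge0 ?(ltW C0) // divr_ge0 ?powR_ge0.
have [re|re] := ltP r e2.
  apply: (@le_trans _ _ (C * r `^ alpha)%:E).
    apply: He => //=; rewrite sub0r normrN gtr0_norm //.
    by apply: (lt_trans re); rewrite /e2; lra.
  by rewrite lee_fin; apply: ler_wpM2r;
    rewrite ?powR_ge0 // lerDl divr_ge0 ?powR_ge0.
apply: (@le_trans _ _ V%:E).
  rewrite /V fineK ?fin_num_measure //; apply: le_measure => //.
  - by rewrite inE; exact: measurable_itv.
  - by rewrite inE.
rewrite lee_fin mulrDl -[leLHS]add0r; apply: lerD;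
  first by rewrite mulr_ge0 ?powR_ge0 ?ltW.
rewrite mulrAC -mulrA; apply: ler_peMr => //.
rewrite ler_pdivlMr ?powR_gt0 // mul1r.
by apply: ge0_ler_powR => //; rewrite ?nnegrE; exact: ltW.
Qed.

Lemma growth_near (C e0 : R) : 0 < C -> 0 < e0 ->
  (forall e : R, 0 < e -> e < e0 -> fine (nu (I e)) <= C * e `^ alpha) ->
  \forall e \near 0^'+, (nu (I e) <= (C * e `^ alpha)%:E)%E.
Proof.
move=> C0 e00 H; near=> e.
have e_gt0 : 0 < e by near: e; exact: nbhs_right_gt.
have e_lt : e < e0 by near: e; exact: nbhs_right_lt.
rewrite -[leLHS]fineK ?lee_fin; first exact: H.
by rewrite fin_num_measure //; exact: measurable_itv.
Unshelve. all: by end_near. Qed.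

End Coefficients.

(** * Assembly of the equivalences *)

Theorem theorem6p2 (R : realType) (alpha : R) (halpha : 1 < alpha)
    (d : nat -> R) (hd : zeta_power_coeffs alpha d)
    (nu : {finite_measure set R -> \bar R}) (hnu : measure_on_half_line nu) :
  [<-> hankel_bounded (fun n => (varrho d nu n)%:C) d;
       exists2 C : R, 0 < C &
         \forall e \near 0^'+,
           (nu (`]2^-1, 2^-1 + e]%classic)%R <= (C * e `^ alpha)%:E)%E;
       exists2 C : R, 0 < C &
         forall n : nat, (2 <= n)%N ->
           varrho d nu n
             <= C * (d n / (Num.sqrt n%:R * (ln n%:R) `^ alpha));
       L2_bounded nu (Kop alpha nu)].
Proof.
have a0 : 0 < alpha by exact: lt_trans ltr01 halpha.
(* Dividing by d_n > 0 turns (3) into a statement about moments alone. *)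
have decayE (C : R) n : (2 <= n)%N ->
    (varrho d nu n <= C * (d n / (Num.sqrt n%:R * (ln n%:R) `^ alpha))) =
    (moment nu n <= C * (Num.sqrt n%:R * (ln n%:R) `^ alpha)^-1).
  move=> n2; rewrite /varrho -/(moment nu n) mulrCA ler_pM2l //.
  by apply: hd.1; exact: ltnW.
have decay_growth :
    (exists2 C : R, 0 < C & forall n : nat, (2 <= n)%N ->
       varrho d nu n <= C * (d n / (Num.sqrt n%:R * (ln n%:R) `^ alpha))) ->
    exists2 C : R, 0 < C & \forall e \near 0^'+,
       (nu (`]2^-1, 2^-1 + e]%classic)%R <= (C * e `^ alpha)%:E)%E.
  move=> [C C0 H]; exists (C * expR 1 * 2 `^ alpha).
    by rewrite !mulr_gt0 ?expR_gt0 ?powR_gt0.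
  apply: (growth_near _ _ _ 1) => //;
    first by rewrite !mulr_gt0 ?expR_gt0 ?powR_gt0.
  by apply: growth_of_moment_decay => // n n2; rewrite -decayE // H.
(* The cycle is (1) => (2) => (3) => (4) => (1); its last two implications pass through (2). *)
tfae.
- move=> /(growth_of_hankel_bounded _ _ _ a0 hd)[C C0 H]; exists C => //.
  by apply: (growth_near _ _ _ 1) => // e e0 _; exact: H.
- move=> [C C0 /(growth_global _ _ a0 _ C0)[C1 C10 gr]].
  have [C2 C20 H] := moment_decay_of_growth _ _ a0 _ C10 gr.
  by exists C2 => // n n2; rewrite decayE // H.
- move=> /decay_growth[C C0 /(growth_global _ _ a0 _ C0)[C1 C10 gr]].
  exact: (L2_bounded_of_growth _ _ _ a0 hd _ C10 gr).
- move=> /(growth_of_L2_bounded _ _ _ a0 hd)[C C0 H].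
  have [|C1 C10 gr] := growth_global nu _ a0 _ C0.
    by apply: (growth_near _ _ _ 1) => // e e0 _; exact: H.
  exact: (hankel_bounded_of_growth _ _ _ a0 hd _ C10 gr).
Qed.
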